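(* Suppose there is a family of Boolean circuits $\{C_t\}$ of fan-in 2 and depth $O(\log t)$ such that for all sufficiently large $t$ there exists $\alpha \in A_t$ for which $C_t$ decides the $\alpha$-product problem over $(A_t)^t$. Then $\mathrm{NC}^1 = \mathrm{L}$.
   Context: $A_t$ is the alternating group of even permutations of $\{1,\dots,t\}$, with identity $\mathrm{id}$. A permutation $\sigma$ given as input to a circuit is encoded in pointwise representation $(\sigma(1),\ldots,\sigma(t))$ using $O(t\log t)$ bits. For a group $G$, $\alpha\in G$ and $t\in\mathbb{N}$, the $\alpha$-product problem over $G^t$ is: given $(x_1,\ldots,x_t)\in G^t$ promised to satisfy $x_1x_2\cdots x_t\in\{\alpha,\mathrm{id}\}$, decide which of the two the product equals. $\mathrm{NC}^1$ is the class of languages decided by polynomial-size, depth-$O(\log n)$ circuit families of fan-in-2 Boolean gates; $\mathrm{L}$ is logarithmic space.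
   Formalization: L is read non-uniformly as L/poly (logarithmic space with polynomial-length advice depending only on the input length), since NC^1 given by arbitrary circuit families contains undecidable languages and so cannot equal uniform L. *)

(* Defs.v *)
From mathcomp Require Import all_boot all_fingroup all_solvable.

Set Implicit Arguments.
Unset Strict Implicit.
Unset Printing Implicit Defensive.

Definition isO (f g : nat -> nat) : Prop :=
  exists c N, forall n, N <= n -> f n <= c * g n.

(* floor (log_2 n) for n > 0. *)
Definition log2 (n : nat) : nat := trunc_log 2 n.

Definition poly_bounded (f : nat -> nat) : Prop :=
  exists k, isO f (fun n => n ^ k).

Section Circuits.

Variable I : Type.

(* A gate that may read the [k] gates preceding it.  [Gate op i j] computes an
   arbitrary Boolean function [op] of two earlier gates; input variables are
   indexed by [I]. *)
Inductive gate (k : nat) : Type :=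
  | Input of I
  | Const of bool
  | Gate of (bool -> bool -> bool) & 'I_k & 'I_k.

Inductive gates : nat -> Type :=
  | NoGate : gates 0
  | AddGate k : gates k -> gate k -> gates k.+1.

Record circuit : Type := Circuit {
  circuit_size : nat;
  circuit_gates : gates circuit_size;
  circuit_output : 'I_circuit_size }.

Definition gate_value (x : I -> bool) (v : seq bool) k (g : gate k) : bool :=
  match g with
  | Input i => x i
  | Const b => b
  | Gate op i j => op (nth false v i) (nth false v j)
  end.

Definition gate_depth (d : seq nat) k (g : gate k) : nat :=
  match g with
  | Input _ => 0
  | Const _ => 0
  | Gate _ i j => (maxn (nth 0 d i) (nth 0 d j)).+1
  end.

Fixpoint gates_values (x : I -> bool) k (gs : gates k) : seq bool :=
  match gs with
  | NoGate => [::]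
  | AddGate _ gs' g =>
      let v := gates_values x gs' in rcons v (gate_value x v g)
  end.

Fixpoint gates_depths k (gs : gates k) : seq nat :=
  match gs with
  | NoGate => [::]
  | AddGate _ gs' g => let d := gates_depths gs' in rcons d (gate_depth d g)
  end.

Definition circuit_eval (C : circuit) (x : I -> bool) : bool :=
  nth false (gates_values x (circuit_gates C)) (circuit_output C).

Definition circuit_depth (C : circuit) : nat :=
  nth 0 (gates_depths (circuit_gates C)) (circuit_output C).

End Circuits.

Definition language : Type := seq bool -> Prop.

Definition NC1 (A : language) : Prop :=
  exists C : forall n, circuit 'I_n,
    [/\ poly_bounded (fun n => circuit_size (C n)),
        isO (fun n => circuit_depth (C n)) log2
      & forall n (x : n.-tuple bool), A x <-> circuit_eval (C n) (tnth x)].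

(* Deterministic Turing machines with a two-way read-only input tape, a two-way
   read-only advice tape, and a read-write work tape infinite to the right. *)

Inductive ro_symbol : Type := LeftEnd | RightEnd | Bit of bool.

Inductive move : Type := MoveLeft | Stay | MoveRight.

Record machine : Type := Machine {
  state : finType;
  work_symbol : finType;
  blank : work_symbol;
  start : state;
  accept : state;
  reject : state;
  delta : state -> ro_symbol -> ro_symbol -> work_symbol ->
          state * work_symbol * (move * move * move) }.

Definition ro_tape (s : seq bool) : seq ro_symbol :=
  LeftEnd :: rcons (map Bit s) RightEnd.

(* The head stays on the cells [0 .. (size s).+1] of [ro_tape s]. *)
Definition ro_move (s : seq bool) (m : move) (p : nat) : nat :=
  match m with
  | MoveLeft => p.-1
  | Stay => p
  | MoveRight => minn p.+1 (size s).+1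
  end.

Definition work_move (m : move) (p : nat) : nat :=
  match m with MoveLeft => p.-1 | Stay => p | MoveRight => p.+1 end.

Record config (M : machine) : Type := Config {
  cstate : state M;
  input_head : nat;
  advice_head : nat;
  work_head : nat;
  work_tape : nat -> work_symbol M }.

Definition init_config (M : machine) : config M :=
  Config (start M) 0 0 0 (fun _ => blank M).

Definition step (M : machine) (x a : seq bool) (c : config M) : config M :=
  if (cstate c == accept M) || (cstate c == reject M) then c else
  let: (q, w, (mi, ma, mw)) :=
    delta (cstate c)
          (nth RightEnd (ro_tape x) (input_head c))
          (nth RightEnd (ro_tape a) (advice_head c))
          (work_tape c (work_head c)) in
  Config q (ro_move x mi (input_head c)) (ro_move a ma (advice_head c))
    (work_move mw (work_head c))
    (fun i => if i == work_head c then w else work_tape c i).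

Definition run (M : machine) (x a : seq bool) (k : nat) : config M :=
  iter k (step x a) (init_config M).

(* On input [x] the advice tape holds [adv (size x)].  The first conjunct
   excludes a machine whose accepting and rejecting states coincide. *)
Definition decides_with_advice
    (M : machine) (adv : nat -> seq bool) (A : language) : Prop :=
  accept M != reject M /\
  forall x,
    (A x -> exists k, cstate (run M x (adv (size x)) k) = accept M) /\
    (~ A x -> exists k, cstate (run M x (adv (size x)) k) = reject M).

Definition uses_log_space (M : machine) (adv : nat -> seq bool) : Prop :=
  exists c N, forall x, N <= size x ->
    forall k, work_head (run M x (adv (size x)) k) <= c * log2 (size x).

(* Logarithmic space, in the same non-uniform setting as [NC1]: advice of
   polynomial length that depends only on the input length (L/poly).  [NC1] as
   defined above contains undecidable languages, so it can only be compared for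
   equality with the non-uniform version of L; uniform L is the special case
   of empty advice. *)
Definition Lpoly (A : language) : Prop :=
  exists (M : machine) (adv : nat -> seq bool),
    [/\ poly_bounded (fun n => size (adv n)),
        decides_with_advice M adv A
      & uses_log_space M adv].

(* Index of an input bit for t-tuples of permutations of t points:
   (i, j, k) is the k-th binary digit of the image of j under the i-th
   permutation; the points are numbered from 0, so up_log 2 t = ceil (log_2 t)
   digits suffice. *)
Definition perm_bit (t : nat) : Type := ('I_t * 'I_t * 'I_(up_log 2 t))%type.

Definition pointwise (t : nat) (x : 'I_t -> {perm 'I_t}) : perm_bit t -> bool :=
  fun '(i, j, k) => odd (x i j %/ 2 ^ k).

(* [D] answers true on product alpha and false on product 1.  On tuples
   violating the promise nothing is required.  No [D] qualifies when alpha = 1: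
   the constant tuple 1 would need both answers. *)
Definition decides_product (gT : finGroupType) (G : {set gT}) (alpha : gT)
    (t : nat) (D : ('I_t -> gT) -> bool) : Prop :=
  forall x : 'I_t -> gT, (forall i, x i \in G) ->
    ((\prod_(i < t) x i)%g = alpha -> D x = true) /\
    ((\prod_(i < t) x i)%g = 1%g -> D x = false).

(* Main.v *)
Require Import Defs.
From mathcomp Require Import all_boot all_fingroup all_solvable.
From mathcomp Require Import zify.
From Stdlib Require Import Classical ClassicalEpsilon.

(* For [NC1] in [Lpoly], a formula is turned into a straight-line program over
   three one-bit registers (Ben-Or and Cleve); its code is the advice, and a
   finite automaton executes it.

   For the converse, the configurations of a machine, layered by time, form a
   forest in which each edge depends on one input bit.  Multiplying the
   transpositions along the edges, in order of time, gives a
   permutation whose cycles are the trees, so that iterating it and counting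
   visits to accepting roots decides reachability reversibly.  A commutator of
   this search with a marking of the start vertex is a fixed involution if the
   machine accepts and the identity otherwise.  Let L be the number of one-bit
   factors used.  If the involution moves 8 L points, then any even [alpha] on
   t points is a product of about t / (4 L) of its conjugates as soon as t is
   large compared with L ^ 2, so t factors are enough to write a product that is
   [alpha] or 1 according to the answer. *)

Set Implicit Arguments.
Unset Strict Implicit.
Unset Printing Implicit Defensive.

(** * Formulas, and their translation from and to circuits of the same depth *)

Inductive formula (I : Type) : Type :=
  | Lit of I
  | Cst of bool
  | Op of (bool -> bool -> bool) & formula I & formula I.

Arguments Cst {I}.

Fixpoint feval I (x : I -> bool) (f : formula I) : bool :=
  match f with
  | Lit i => x i
  | Cst b => b
  | Op op f1 f2 => op (feval x f1) (feval x f2)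
  end.

Fixpoint fdepth I (f : formula I) : nat :=
  match f with
  | Lit _ => 0
  | Cst _ => 0
  | Op _ f1 f2 => (maxn (fdepth f1) (fdepth f2)).+1
  end.

Fixpoint fsubst I J (s : I -> formula J) (f : formula I) : formula J :=
  match f with
  | Lit i => s i
  | Cst b => Cst b
  | Op op f1 f2 => Op op (fsubst s f1) (fsubst s f2)
  end.

Lemma feval_subst I J (s : I -> formula J) f (x : J -> bool) :
  feval x (fsubst s f) = feval (fun i => feval x (s i)) f.
Proof. by elim: f => //= op f1 -> f2 ->. Qed.

Lemma feval_ext I (f : formula I) (x y : I -> bool) :
  x =1 y -> feval x f = feval y f.
Proof. by move=> exy; elim: f => //= op f1 -> f2 ->. Qed.

Lemma fdepth_subst I J (s : I -> formula J) f d :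
  (forall i, fdepth (s i) <= d) -> fdepth (fsubst s f) <= fdepth f + d.
Proof.
by move=> sd; elim: f => //= op f1 IH1 f2 IH2; rewrite addSn ltnS; lia.
Qed.

Section CircuitFormula.

Variable I : Type.

Definition gate_formula (F : seq (formula I)) k (g : gate I k) : formula I :=
  match g with
  | Input i => Lit i
  | Const b => Cst b
  | Gate op i j => Op op (nth (Cst false) F i) (nth (Cst false) F j)
  end.

Fixpoint gates_formulas k (gs : gates I k) : seq (formula I) :=
  match gs with
  | NoGate => [::]
  | AddGate _ gs' g =>
      let F := gates_formulas gs' in rcons F (gate_formula F g)
  end.

Lemma size_gates_formulas k (gs : gates I k) : size (gates_formulas gs) = k.
Proof. by elim: gs => //= k' gs IH g; rewrite size_rcons IH. Qed.

Lemma gates_valuesE x k (gs : gates I k) :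
  gates_values x gs = map (feval x) (gates_formulas gs).
Proof.
elim: gs => //= k' gs -> g; rewrite map_rcons; congr rcons.
case: g => //= op i j.
by rewrite !(nth_map (Cst false)) ?size_gates_formulas.
Qed.

Lemma gates_depthsE k (gs : gates I k) :
  gates_depths gs = map (@fdepth I) (gates_formulas gs).
Proof.
elim: gs => //= k' gs -> g; rewrite map_rcons; congr rcons.
case: g => //= op i j.
by rewrite !(nth_map (Cst false)) ?size_gates_formulas.
Qed.

Lemma formula_of_circuit (C : circuit I) :
  exists f : formula I,
    fdepth f = circuit_depth C /\ forall x, feval x f = circuit_eval C x.
Proof.
exists (nth (Cst false) (gates_formulas (circuit_gates C)) (circuit_output C)).
rewrite /circuit_depth gates_depthsE; split=> [|x].
  by rewrite (nth_map (Cst false)) ?size_gates_formulas.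
rewrite /circuit_eval gates_valuesE.
by rewrite (nth_map (Cst false)) ?size_gates_formulas.
Qed.

Lemma size_gates_values x k (gs : gates I k) : size (gates_values x gs) = k.
Proof. by rewrite gates_valuesE size_map size_gates_formulas. Qed.

Lemma size_gates_depths k (gs : gates I k) : size (gates_depths gs) = k.
Proof. by rewrite gates_depthsE size_map size_gates_formulas. Qed.

Lemma compile_gate k (gs : gates I k) (g : gate I k) (f : formula I) :
  (forall x, gate_value x (gates_values x gs) g = feval x f) ->
  gate_depth (gates_depths gs) g = fdepth f ->
  let gs' := AddGate gs g in
  [/\ forall x, take k (gates_values x gs') = gates_values x gs,
      take k (gates_depths gs') = gates_depths gs,
      forall x, nth false (gates_values x gs') k = feval x f
    & nth 0 (gates_depths gs') k = fdepth f].
Proof.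
move=> gv gd; split=> [x||x|] /=.
- by rewrite -cats1 takel_cat ?take_oversize ?size_gates_values.
- by rewrite -cats1 takel_cat ?take_oversize ?size_gates_depths.
- by rewrite nth_rcons size_gates_values ltnn eqxx gv.
- by rewrite nth_rcons size_gates_depths ltnn eqxx gd.
Qed.

(** Gates are appended to an arbitrary list [gs]. The two [take] equations keep the output of the
    first subformula readable after the second is compiled, and the strict size bound leaves room
    for the gate that joins them. *)
Lemma compile_formula f k (gs : gates I k) :
  exists k' (gs' : gates I k') (o : 'I_k'),
    [/\ k <= k', k' < k + 2 ^ (fdepth f).+1 &
    [/\ forall x, take k (gates_values x gs') = gates_values x gs,
        take k (gates_depths gs') = gates_depths gs,
        forall x, nth false (gates_values x gs') o = feval x f
      & nth 0 (gates_depths gs') o = fdepth f]].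
Proof.
elim: f k gs => [i|b|op f1 IH1 f2 IH2] k gs.
- exists k.+1, (AddGate gs (Input _ i)), ord_max; split; try by rewrite /=; lia.
  exact: compile_gate.
- exists k.+1, (AddGate gs (Const _ _ b)), ord_max; split; try by rewrite /=; lia.
  exact: compile_gate.
have [k1 [gs1 [o1 [kk1 k1k [v1 d1 ev1 dp1]]]]] := IH1 k gs.
have [k2 [gs2 [o2 [k12 k2k [v2 d2 ev2 dp2]]]]] := IH2 k1 gs1.
pose g := Gate I op (widen_ord k12 o1) o2.
have [||v3 d3 ev3 dp3] := @compile_gate k2 gs2 g (Op op f1 f2).
- by move=> x /=; rewrite ev2 -ev1 -v2 nth_take.
- by rewrite /= dp2 -dp1 -d2 nth_take.
exists k2.+1, (AddGate gs2 g), ord_max; split; first by lia.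
  rewrite /= [2 ^ _.+2]expnS mul2n -addnn.
  have e1 : 2 ^ (fdepth f1).+1 <= 2 ^ (maxn (fdepth f1) (fdepth f2)).+1.
    by rewrite leq_exp2l // ltnS leq_maxl.
  have e2 : 2 ^ (fdepth f2).+1 <= 2 ^ (maxn (fdepth f1) (fdepth f2)).+1.
    by rewrite leq_exp2l // ltnS leq_maxr.
  lia.
split=> // [x|].
- by rewrite -(take_takel _ kk1) -(take_takel _ k12) v3 v2 v1.
- by rewrite -(take_takel _ kk1) -(take_takel _ k12) d3 d2 d1.
Qed.

Lemma circuit_of_formula (f : formula I) :
  exists C : circuit I,
    [/\ circuit_size C <= 2 ^ (fdepth f).+1, circuit_depth C = fdepth f
      & forall x, circuit_eval C x = feval x f].
Proof.
have [k [gs [o [_ kb [_ _ ev dp]]]]] := compile_formula f (NoGate I).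
by exists (Circuit gs o); split=> //; rewrite /= -[2 ^ _]add0n ltnW.
Qed.

End CircuitFormula.

(** Serves the finitely many input lengths below the threshold of the space bound, where depth is
    irrelevant. *)
Lemma formula_of_function n (g : n.-tuple bool -> bool) :
  exists f : formula 'I_n, forall x : n.-tuple bool, feval (tnth x) f = g x.
Proof.
(* Shannon expansion, by induction on a list [s] of variables that determine the function. *)
suff H (s : seq 'I_n) (h : n.-tuple bool -> bool) :
    (forall x y : n.-tuple bool,
       {in s, forall i, tnth x i = tnth y i} -> h x = h y) ->
    exists f : formula 'I_n, forall x : n.-tuple bool, feval (tnth x) f = h x.
  apply: (H (enum 'I_n)) => x y exy; congr g; apply: eq_from_tnth => i.
  by apply: exy; rewrite mem_enum.
elim: s h => [|i s IH] h hs.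
  by exists (Cst (h [tuple false | _ < n])) => x /=; apply: hs.
pose upd b (x : n.-tuple bool) : n.-tuple bool :=
  [tuple if j == i then b else tnth x j | j < n].
have hupd b : exists f : formula 'I_n, forall x, feval (tnth x) f = h (upd b x).
  apply: (IH (fun x => h (upd b x))) => x y exy; apply: hs => j.
  rewrite inE !tnth_mktuple; case: eqP => //= _ js; exact: exy.
have [[f1 e1] [f0 e0]] := (hupd true, hupd false).
exists (Op orb (Op andb (Lit i) f1) (Op (fun a b => ~~ a && b) (Lit i) f0)).
move=> x /=; rewrite e1 e0.
case xi: (tnth x i); rewrite /= ?orbF; apply: hs => j _;
  by rewrite tnth_mktuple; case: eqP => // ->.
Qed.
(** * Register programs run by a finite automaton *)

Definition regs := {ffun 'I_3 -> bool}.

(* [inl b] moves the input head (right iff [b]); [inr (c, (i, j))] adds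
   register [j] to register [i] modulo 2, if [c] only when the scanned input
   bit is 1. *)
Definition instr : finType := (bool + bool * ('I_3 * 'I_3))%type.

Definition is_one (s : ro_symbol) : bool := if s is Bit b then b else false.

Definition instr_regs (s : ro_symbol) (t : instr) (r : regs) : regs :=
  match t with
  | inl _ => r
  | inr (c, (i, j)) =>
      [ffun l => r l (+) [&& l == i, r j & c ==> is_one s]]
  end.

Definition instr_move (t : instr) : move :=
  match t with
  | inl b => if b then MoveRight else MoveLeft
  | inr _ => Stay
  end.

Definition exec1 (x : seq bool) (s : regs * nat) (t : instr) : regs * nat :=
  (instr_regs (nth RightEnd (ro_tape x) s.2) t s.1,
   ro_move x (instr_move t) s.2).

Definition exec x s (p : seq instr) := foldl (exec1 x) s p.

Definition reg_add (c : bool) (i j : 'I_3) : instr := inr (c, (i, j)).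

(* Adds [R_j * f(x)] to [R_i]: writing [op] as a polynomial over F_2, the
   product term is obtained from
   [R_k += R_j a; R_i += R_k b; R_k += R_j a; R_i += R_k b]. *)
Fixpoint program n (f : formula 'I_n) (i j k : 'I_3) : seq instr :=
  match f with
  | Lit v => nseq v.+1 (inl true) ++ reg_add true i j :: nseq v.+1 (inl false)
  | Cst b => if b then [:: reg_add false i j] else [::]
  | Op op f1 f2 =>
      (if op false false then [:: reg_add false i j] else [::]) ++
      (if op false false (+) op true false then program f1 i j k else [::]) ++
      (if op false false (+) op false true then program f2 i j k else [::]) ++
      (if op false false (+) op false true (+) op true false (+) op true true
       then program f1 k j i ++ program f2 i k j ++
            program f1 k j i ++ program f2 i k j
       else [::])
  end.

Lemma exec_right (x : seq bool) (r : regs) p m :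
  p + m <= (size x).+1 -> exec x (r, p) (nseq m (inl true)) = (r, p + m).
Proof.
elim: m p => [|m IH] p pm /=; first by rewrite addn0.
rewrite /exec /= /exec1 /= -[foldl _ _ _]/(exec _ _ _).
have -> : minn p.+1 (size x).+1 = p.+1 by lia.
by rewrite IH ?addSnnS.
Qed.

Lemma exec_left (x : seq bool) (r : regs) m :
  exec x (r, m) (nseq m (inl false)) = (r, 0).
Proof. by elim: m. Qed.

Lemma nth_ro_tape n (x : n.-tuple bool) (i : 'I_n) :
  nth RightEnd (ro_tape x) i.+1 = Bit (tnth x i).
Proof.
rewrite /ro_tape /= nth_rcons size_map size_tuple ltn_ord.
by rewrite (nth_map false) ?size_tuple // -tnth_nth.
Qed.

Lemma exec_cat x s p1 p2 : exec x s (p1 ++ p2) = exec x (exec x s p1) p2.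
Proof. exact: foldl_cat. Qed.

Definition add_reg (i j : 'I_3) (v : bool) (r : regs) : regs :=
  [ffun l => r l (+) [&& l == i, r j & v]].

Lemma add_reg0 i j r : add_reg i j false r = r.
Proof. by apply/ffunP => l; rewrite ffunE !andbF addbF. Qed.

Lemma add_regD i j v w r :
  i != j -> add_reg i j v (add_reg i j w r) = add_reg i j (w (+) v) r.
Proof.
move=> ij; apply/ffunP => l; rewrite !ffunE [j == i]eq_sym (negbTE ij).
by case: (l == i); case: (r l); case: (r j); case: w; case: v.
Qed.

(** Register [k] receives [a R_j] twice and is restored. Register [i] receives [b R_k] twice, only
    once with [a R_j] included in [R_k], so [a b R_j] remains. *)
Lemma add_regM i j k a b r : i != j -> i != k -> j != k ->
  add_reg i k b (add_reg k j a (add_reg i k b (add_reg k j a r))) =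
  add_reg i j (a && b) r.
Proof.
move=> ij ik jk; apply/ffunP => l.
rewrite !ffunE eqxx (negbTE jk) [k == i]eq_sym (negbTE ik).
rewrite [j == i]eq_sym (negbTE ij) /=.
case: (eqVneq l i) => [->|_]; first rewrite (negbTE ik) /=;
  by case: (l == k); case: (r i); case: (r j); case: (r k); case: a; case: b;
     case: (r l).
Qed.

Lemma exec_program n (f : formula 'I_n) (x : n.-tuple bool) (r : regs) i j k :
  i != j -> i != k -> j != k ->
  exec x (r, 0) (program f i j k) = (add_reg i j (feval (tnth x) f) r, 0).
Proof.
elim: f r i j k => [v|b|op f1 IH1 f2 IH2] r i j k ij ik jk.
- rewrite -[program _ _ _ _]/(nseq v.+1 (inl true) ++ [:: reg_add true i j] ++
    nseq v.+1 (inl false)).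
  rewrite !exec_cat exec_right ?add0n ?size_tuple // 1?ltnW ?ltnS //.
  rewrite [exec x (r, _) _]/(exec1 x (r, v.+1) (reg_add true i j)) /exec1.
  by rewrite exec_left nth_ro_tape.
- by case: b; rewrite /= ?add_reg0.
have ki : k != i by rewrite eq_sym.
have kj : k != j by rewrite eq_sym.
have ji : j != i by rewrite eq_sym.
have ex_if (c v : bool) p r' :
    exec x (r', 0) p = (add_reg i j v r', 0) ->
    exec x (r', 0) (if c then p else [::]) = (add_reg i j (c && v) r', 0).
  by case: c => //; rewrite /= add_reg0.
rewrite [program _ _ _ _]/= exec_cat (@ex_if _ true) //.
rewrite exec_cat (@ex_if _ (feval (tnth x) f1)) ?IH1 //.
rewrite exec_cat (@ex_if _ (feval (tnth x) f2)) ?IH2 //.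
rewrite (@ex_if _ (feval (tnth x) f1 && feval (tnth x) f2)); last first.
  by rewrite !exec_cat IH1 // IH2 // IH1 // IH2 // add_regM.
(* The four blocks add the constant, the two linear terms and the product term of the polynomial of
   [op]; its value is checked by cases. *)
rewrite !add_regD //; congr (add_reg i j _ r, 0) => /=.
by case: (feval _ f1); case: (feval _ f2); case: (op _ _); case: (op _ _);
  case: (op _ _); case: (op _ _).
Qed.

(** A level costs one constant instruction, one subprogram for each linear term and four for the
    product term, hence the factor 7. *)
Lemma size_program n (f : formula 'I_n) i j k :
  size (program f i j k) <= (2 * n + 1) * 7 ^ fdepth f.
Proof.
elim: f i j k => [v|b|op f1 IH1 f2 IH2] i j k.
- by rewrite size_cat /= !size_nseq; have := ltn_ord v; lia.
- by case: b => /=; lia.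
have le7 a b : (2 * n + 1) * 7 ^ a <= (2 * n + 1) * 7 ^ maxn a b.
  by rewrite leq_mul // leq_exp2l // leq_maxl.
have le7' a b : (2 * n + 1) * 7 ^ b <= (2 * n + 1) * 7 ^ maxn a b.
  by rewrite leq_mul // leq_exp2l // leq_maxr.
have p0 m : 0 < (2 * n + 1) * 7 ^ m by rewrite muln_gt0 expn_gt0 addn1.
have := p0 (maxn (fdepth f1) (fdepth f2)).
rewrite [program _ _ _ _]/= [fdepth _]/= expnS mulnCA.
have {}le1 := le7 (fdepth f1) (fdepth f2).
have {}le2 := le7' (fdepth f1) (fdepth f2).
have b1 i' j' k' := leq_trans (IH1 i' j' k') le1.
have b2 i' j' k' := leq_trans (IH2 i' j' k') le2.
move: (_ * 7 ^ maxn _ _) b1 b2 => m b1 b2 m0.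
have := (b1 i j k, b2 i j k, b1 k j i, b2 i k j).
rewrite !size_cat => -[[[h1 h2] h3] h4].
have if_le (b : bool) (p : seq instr) u : size p <= u ->
  size (if b then p else [::]) <= u by case: b.
have q0 := if_le (op false false) [:: reg_add false i j] 1 (leqnn 1).
have q1 := if_le (op false false (+) op true false) _ _ h1.
have q2 := if_le (op false false (+) op false true) _ _ h2.
have q3 : size (program f1 k j i ++ program f2 i k j ++
            program f1 k j i ++ program f2 i k j) <= 4 * m.
  by rewrite !size_cat; lia.
have {}q3 := if_le (op false false (+) op false true (+) op true false
                     (+) op true true) _ _ q3.
apply: leq_trans (leq_add q0 (leq_add q1 (leq_add q2 q3))) _; lia.
Qed.

(* An instruction is written on the advice tape as its index in unary. *)
Definition code (t : instr) : seq bool :=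
  rcons (nseq (index t (enum instr)) true) false.

(* Locked, since [#|instr|] must not be unfolded by conversion. *)
Definition num_instr : nat := locked #|instr|.

Lemma index_instr (t : instr) : index t (enum instr) < num_instr.
Proof. by rewrite /num_instr -lock cardE index_mem mem_enum. Qed.

Definition counter : finType := 'I_(num_instr.+1).

(** Register 1 starts at 1, so adding [R_1 * f(x)] to the empty register 0 leaves the value of the
    formula there. *)
Definition regs_start : regs := [ffun i : 'I_3 => i == 1 :> nat].

(** All memory is in the state: the registers and the number of ones read in the current code. A
    zero ends the code and triggers its instruction; the right end of the advice halts the
    machine. *)
Definition program_delta (q : bool + regs * counter) (s a : ro_symbol)
    (w : unit) : (bool + regs * counter) * unit * (move * move * move) :=
  match q, a with
  | inl b, _ => (inl b, tt, (Stay, Stay, Stay))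
  | inr _, LeftEnd => (q, tt, (Stay, MoveRight, Stay))
  | inr (r, _), RightEnd => (inl (r ord0), tt, (Stay, Stay, Stay))
  | inr (r, k), Bit true => (inr (r, inord k.+1), tt, (Stay, MoveRight, Stay))
  | inr (r, k), Bit false =>
      let t := nth (inl true) (enum instr) k in
      (inr (instr_regs s t r, ord0), tt, (instr_move t, MoveRight, Stay))
  end.

Definition program_machine : machine :=
  @Machine (bool + regs * counter)%type unit tt (inr (regs_start, ord0))
    (inl true) (inl false) program_delta.

Definition exec_bit (x : seq bool) (s : regs * counter * nat) (b : bool) :
    regs * counter * nat :=
  let: (r, k, p) := s in
  if b then (r, inord k.+1, p) else
  let: (r', p') := exec1 x (r, p) (nth (inl true) (enum instr) k) in
  (r', ord0, p').

Definition snapshot (c : config program_machine) s h : Prop :=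
  [/\ cstate c = inr s.1, input_head c = s.2 & advice_head c = h].

(** Splitting the advice lets the induction on the part already read keep the tape fixed. The
    additional step leaves the left end marker. *)
Lemma run_program_bits (x s1 s2 : seq bool) :
  snapshot (run program_machine x (s1 ++ s2) (size s1).+1)
    (foldl (exec_bit x) (regs_start, ord0, 0) s1) (size s1).+1.
Proof.
elim/last_ind: s1 s2 => [|s1 b IH] s2.
  by split=> //=; rewrite /step /=; case: (size s2).
have {IH} := IH (b :: s2); rewrite -cat_rcons.
rewrite size_rcons [run _ _ _ _.+2]/(run _ _ _ _) iterS -/(run _ _ _ _).
rewrite foldl_rcons.
case: (run _ _ _ _) => q p h w t [/= -> -> ->].
case: (foldl _ _ _) => [[r k] p'] /=.
rewrite /step /= /ro_tape nth_rcons size_map size_cat size_rcons.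
rewrite addSn ltnS leq_addr (nth_map false) ?size_cat ?size_rcons; last by lia.
rewrite cat_rcons nth_cat ltnn subnn [nth false _ _]/=.
case: b => /=; split=> //=.
all: by rewrite size_cat /=; lia.
Qed.

Lemma exec_code x t r p :
  foldl (exec_bit x) (r, ord0, p) (code t) =
  let: (r', p') := exec1 x (r, p) t in (r', ord0, p').
Proof.
have cnt m : m <= num_instr -> foldl (exec_bit x) (r, ord0, p) (nseq m true) =
   (r, inord m, p).
  elim: m => [|m IH] lm.
    by rewrite /=; congr (_, _, _); apply: val_inj; rewrite /= inordK.
  have -> : nseq m.+1 true = rcons (nseq m true) true
    by rewrite -cats1 -[[:: true]]/(nseq 1 true) -nseqD addn1.
  by rewrite foldl_rcons IH ?(ltnW lm) //= inordK // ltnW.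
have it := index_instr t.
rewrite /code foldl_rcons cnt ?(ltnW it) //.
by rewrite /exec_bit inordK 1?ltnS ?(ltnW it) // nth_index ?mem_enum.
Qed.

Lemma exec_codes x ps r p :
  foldl (exec_bit x) (r, ord0, p) (flatten (map code ps)) =
  let: (r', p') := exec x (r, p) ps in (r', ord0, p').
Proof.
elim: ps r p => [//|t ps IH] r p; rewrite /= foldl_cat exec_code.
by case: (exec1 _ _ _) => r' p'; exact: IH.
Qed.

Lemma size_codes ps : size (flatten (map code ps)) <= num_instr * size ps.
Proof.
elim: ps => [|t ps IH] //=.
rewrite size_cat size_rcons size_nseq mulnS leq_add //.
exact: index_instr.
Qed.

Lemma program_machine_head x a k : work_head (run program_machine x a k) = 0.
Proof.
elim: k => [//|k IH]; rewrite /run iterS -/(run _ _ _ k).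
move: IH; case: (run _ _ _ _) => q p h w t /= ->.
rewrite /step /=; case: ifP => // _.
by case: q => [b|[r c]] //=; case: (nth RightEnd _ h) => [||[]].
Qed.

Definition ord3 (k : nat) : 'I_3 := inord k.

Lemma run_program n (f : formula 'I_n) (x : n.-tuple bool) :
  exists k, cstate (run program_machine x
    (flatten (map code (program f (ord3 0) (ord3 1) (ord3 2)))) k) =
    inl (feval (tnth x) f).
Proof.
set a := flatten _.
(* One step for the left marker, one per advice bit, one to halt at the right marker. *)
exists (size a).+2; rewrite /run iterS -/(run _ _ _ _).
have := run_program_bits x a [::]; rewrite cats0 exec_codes.
rewrite exec_program; try by rewrite -val_eqE /= !inordK.
case: (run _ _ _ _) => q p h w t [/= -> -> ->].
rewrite /step /= /ro_tape nth_rcons size_map ltnn eqxx /=.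
by rewrite !ffunE /= -!val_eqE /= !inordK.
Qed.

(** * Polynomial growth, and the inclusion of [NC1] in [Lpoly] *)

Lemma poly_bounded_le f g :
  (exists N, forall n, N <= n -> f n <= g n) -> poly_bounded g ->
  poly_bounded f.
Proof.
move=> [N fg] [k [c [N' gk]]]; exists k, c, (maxn N N') => n nN.
by rewrite (leq_trans (fg n _)) ?gk //; lia.
Qed.

Lemma poly_bounded_mul f g :
  poly_bounded f -> poly_bounded g -> poly_bounded (fun n => f n * g n).
Proof.
move=> [k [c [N fk]]] [k' [c' [N' gk]]].
exists (k + k'), (c * c'), (maxn N N') => n nN.
by rewrite expnD mulnACA leq_mul ?fk ?gk //; lia.
Qed.

Lemma poly_bounded_const c : poly_bounded (fun=> c).
Proof. by exists 0, c, 0 => n _; rewrite expn0 muln1. Qed.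

Lemma poly_bounded_id : poly_bounded id.
Proof. by exists 1, 1, 0 => n _; rewrite expn1 mul1n. Qed.

Lemma poly_bounded_add f g :
  poly_bounded f -> poly_bounded g -> poly_bounded (fun n => f n + g n).
Proof.
move=> pf pg; apply: (@poly_bounded_le _ (fun n => (f n).+1 * (g n).+1)).
  by exists 0 => n _; nia.
have p1 h : poly_bounded h -> poly_bounded (fun n => (h n).+1).
  move=> [k [c [N hk]]]; exists k, c.+1, (maxn N 1) => n nN.
  rewrite mulSn -addn1 addnC leq_add ?expn_gt0 ?hk //; lia.
exact: poly_bounded_mul (p1 _ pf) (p1 _ pg).
Qed.

Lemma poly_bounded_exp f m :
  poly_bounded f -> poly_bounded (fun n => f n ^ m).
Proof.
move=> pf; elim: m => [|m IH].
  by apply: poly_bounded_le (poly_bounded_const 1); exists 0 => n.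
apply: poly_bounded_le (poly_bounded_mul pf IH).
by exists 0 => n _; rewrite expnS.
Qed.

Lemma leq_exp2r_weak m n e : m <= n -> m ^ e <= n ^ e.
Proof. by case: e => // e mn; rewrite leq_exp2r. Qed.

Lemma poly_bounded_exp_log b f :
  0 < b -> isO f log2 -> poly_bounded (fun n => b ^ f n).
Proof.
move=> b0 [c [N fl]]; exists (b * c), 1, (maxn N 1) => n nN; rewrite mul1n.
have fn : f n <= c * log2 n by apply: fl; lia.
apply: leq_trans (leq_pexp2l b0 fn) _.
apply: leq_trans (leq_exp2r_weak _ (ltnW (ltn_expl b (ltnSn 1)))) _.
rewrite -!expnM [c * _]mulnC mulnCA expnM leq_exp2r_weak // trunc_logP //; lia.
Qed.

Lemma dependent_choice (I : Type) (T : I -> Type) (P : forall i, T i -> Prop) :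
  (forall n, exists y, P n y) -> exists f, forall n, P n (f n).
Proof.
move=> ex.
exists (fun n => proj1_sig (constructive_indefinite_description _ (ex n))).
by move=> n; case: (constructive_indefinite_description _ _).
Qed.

Lemma NC1_sub_Lpoly A : NC1 A -> Lpoly A.
Proof.
move=> [C [_ C_depth CA]].
have [F FE] := dependent_choice (fun n => formula_of_circuit (C n)).
pose adv n := flatten (map code (program (F n) (ord3 0) (ord3 1) (ord3 2))).
exists program_machine, adv; split; last 1 first.
- by exists 0, 0 => x _ k; rewrite program_machine_head.
- have pb : poly_bounded
      (fun n => num_instr * ((2 * n + 1) * 7 ^ circuit_depth (C n))).
    apply: poly_bounded_mul (poly_bounded_const _) _.
    apply: poly_bounded_mul (poly_bounded_exp_log _ C_depth) => //.
    apply: poly_bounded_add (poly_bounded_const 1).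
    exact: poly_bounded_mul (poly_bounded_const 2) poly_bounded_id.
  apply: poly_bounded_le pb; exists 0 => n _.
  apply: leq_trans (size_codes _) _; rewrite leq_mul2l.
  by have [<- _] := FE n; rewrite size_program orbT.
split=> // x; have [k] := run_program (F (size x)) (in_tuple x).
rewrite -/(adv _) (FE _).2; have := CA _ (in_tuple x).
rewrite [tval (in_tuple x)]/=.
case: (circuit_eval _ _) => -[Ax xA] runk; split=> Ax'.
- by exists k.
- by case: Ax'; apply: xA.
- by have := Ax Ax'.
- by exists k.
Qed.
(** * Products of permutations that depend on one input bit each *)

(** A position at or beyond [n] reads the default, which forces [g] to be constant; thus constants
    are local even for [n = 0]. *)
Definition local n (T : Type) (g : n.-tuple bool -> T) : Prop :=
  exists i, forall x y : n.-tuple bool,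
    nth false x i = nth false y i -> g x = g y.

Definition local_product n (gT : finGroupType) (H : {set gT}) (k : nat)
    (F : n.-tuple bool -> gT) : Prop :=
  exists phi : nat -> n.-tuple bool -> gT,
    [/\ forall i, local (phi i), forall i x, phi i x \in H
      & forall x, F x = (\prod_(i < k) phi i x)%g].

Lemma local_const n T (c : T) : local (fun _ : n.-tuple bool => c).
Proof. by exists 0. Qed.

Lemma local_comp n T U (h : T -> U) (g : n.-tuple bool -> T) :
  local g -> local (fun x => h (g x)).
Proof. by move=> [i gi]; exists i => x y e; rewrite (gi x y e). Qed.

Lemma local_formula n (g : n.-tuple bool -> bool) : local g ->
  exists2 f : formula 'I_n, fdepth f <= 1 & forall x, feval (tnth x) f = g x.
Proof.
move=> [i gi]; have [ni|ltn] := leqP n i.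
  exists (Cst (g [tuple of nseq n false])) => // x; apply: gi.
  by rewrite !nth_default ?size_tuple.
(* The constant tuple with value [x_i] agrees with [x] at position [i], so [g] can be evaluated
   there. *)
exists (Op (fun b _ => g [tuple of nseq n b]) (Lit (Ordinal ltn))
          (Lit (Ordinal ltn))) => // x /=.
by apply: gi; rewrite nth_nseq ltn (tnth_nth false).
Qed.

Section LocalProduct.

Variables (n : nat) (gT : finGroupType) (H : {group gT}).
Implicit Types (F : n.-tuple bool -> gT).
Local Open Scope group_scope.

Lemma local_product_eq k F F' :
  F =1 F' -> local_product H k F -> local_product H k F'.
Proof. by move=> e [phi [l m p]]; exists phi; split=> // x; rewrite -e. Qed.

Lemma local_product_local F :
  (forall x, F x \in H) -> local F -> local_product H 1 F.
Proof.
by move=> FH lF; exists (fun=> F); split=> // x; rewrite big_ord_recl big_ord0 mulg1.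
Qed.

Lemma local_product1 k : local_product H k (fun _ : n.-tuple bool => 1).
Proof.
exists (fun _ _ => 1); split=> // [i|x]; first exact: local_const.
by rewrite big1.
Qed.

Lemma local_product_mul k1 k2 F1 F2 :
  local_product H k1 F1 -> local_product H k2 F2 ->
  local_product H (k1 + k2) (fun x => F1 x * F2 x).
Proof.
move=> [p1 [l1 m1 e1]] [p2 [l2 m2 e2]].
exists (fun i => if i < k1 then p1 i else p2 (i - k1)%N); split=> [i|i x|x].
- by case: ifP.
- by case: ifP.
rewrite e1 e2 big_split_ord /=; congr (_ * _); apply: eq_bigr => i _.
  by rewrite ltn_ord.
by rewrite ltnNge leq_addr addKn.
Qed.

Lemma local_product_leq k k' F :
  k <= k' -> local_product H k F -> local_product H k' F.
Proof.
move=> /subnKC <- lF; apply: local_product_eq (local_product_mul lF (local_product1 _)).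
by move=> x; rewrite mulg1.
Qed.

Lemma local_product_inv k F :
  local_product H k F -> local_product H k (fun x => (F x)^-1).
Proof.
move=> [phi [l m e]]; elim: k F e => [|k IH] F e.
  apply: local_product_eq (local_product1 0) => x.
  by rewrite e big_ord0 invg1.
have lV : local_product H 1 (fun x => (phi k x)^-1).
  by apply: local_product_local => [x|]; rewrite ?groupV //; apply: local_comp.
apply: local_product_eq (local_product_mul lV (IH _ (fun=> erefl))) => x.
by rewrite e big_ord_recr /= invMg.
Qed.

Lemma local_product_prod (I : eqType) (s : seq I) k
    (F : I -> n.-tuple bool -> gT) :
  {in s, forall i, local_product H k (F i)} ->
  local_product H (size s * k) (fun x => \prod_(i <- s) F i x).
Proof.
elim: s => [|i s IH] lF.
  by apply: local_product_eq (local_product1 _) => x; rewrite big_nil.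
have lFs : {in s, forall i, local_product H k (F i)}.
  by move=> i' si; apply: lF; rewrite inE si orbT.
apply: local_product_eq (local_product_mul (lF i (mem_head _ _)) (IH lFs)) => x.
by rewrite big_cons.
Qed.

Lemma local_product_exp k F m :
  local_product H k F -> local_product H (m * k) (fun x => F x ^+ m).
Proof.
move=> lF; elim: m => [|m IH].
  by apply: local_product_eq (local_product1 _) => x; rewrite expg0.
by apply: local_product_eq (local_product_mul lF IH) => x; rewrite expgS.
Qed.

End LocalProduct.

Lemma local_product_morph n (gT hT : finGroupType) (H : {group gT})
    (K : {group hT}) (h : gT -> hT) k (F : n.-tuple bool -> gT) :
  {morph h : a b / (a * b)%g} -> (forall a, h a \in K) ->
  local_product H k F -> local_product K k (fun x => h (F x)).
Proof.
move=> hM hK [phi [l m e]]; exists (fun i x => h (phi i x)); split=> [i|//|x].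
  exact: local_comp.
have h1 : h 1%g = 1%g by apply: (mulIg (h 1%g)); rewrite -hM !mul1g.
by rewrite e (big_morph h hM h1).
Qed.

(** * The cycle around a tree *)

Section TreeCycle.

Variables (V : finType) (f : V -> V) (rank : V -> nat).
Hypothesis rank_f : forall v, f v != v -> rank v < rank (f v).

Definition tree_perm (s : seq V) : {perm V} :=
  (\prod_(v <- s) tperm v (f v))%g.

Lemma tree_perm_cons v s x :
  tree_perm (v :: s) x = tree_perm s (tperm v (f v) x).
Proof. by rewrite /tree_perm big_cons permM. Qed.

Lemma tree_perm_fix v s :
  v \notin s -> {in s, forall u, f u != v} -> tree_perm s v = v.
Proof.
elim: s => [|u s IH] vs fs; first by rewrite /tree_perm big_nil perm1.
move: vs; rewrite inE negb_or eq_sym tree_perm_cons => /andP[uv vs].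
rewrite tpermD //; last by rewrite fs ?mem_head.
by apply: IH => // w ws; rewrite fs // inE ws orbT.
Qed.

(** Each transposition exchanges points on which [g] agrees. With [g] the map to the root, cycles
    cannot leave their tree. *)
Lemma tree_perm_invariant (T : Type) (g : V -> T) s v :
  (forall u, g (f u) = g u) -> g (tree_perm s v) = g v.
Proof.
move=> gf; elim: s v => [|u s IH] v; first by rewrite /tree_perm big_nil perm1.
by rewrite tree_perm_cons IH; case: tpermP => // ->.
Qed.

(* Multiplying by [tperm v (f v)] when [v] is fixed inserts [v] into the cycle
   of [f v]; increasing rank ensures that each [v] is still fixed when its
   turn comes. *)
Lemma tree_perm_connect s :
  sorted (relpre rank leq) s -> uniq s ->
  {in s, forall u, fconnect (tree_perm s) u (f u)}.
Proof.
elim: s => [//|v s IH] sv /andP[vs us].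
have {}IH := IH (path_sorted sv) us.
have [fv|fv] := eqVneq (f v) v.
  have -> : tree_perm (v :: s) = tree_perm s.
    by rewrite /tree_perm big_cons fv tperm1 mul1g.
  by move=> u; rewrite inE => /predU1P[->|/IH //]; rewrite fv connect0.
have vfix : tree_perm s v = v.
  apply: tree_perm_fix => // u us'; apply/eqP => fu.
  have tr : transitive (relpre rank leq) by move=> a b c; apply: leq_trans.
  have /allP/(_ u us') /= vu := order_path_min tr sv.
  have uv : u != v by apply: contraNneq vs => <-.
  by have := @rank_f u; rewrite fu eq_sym uv => /(_ isT); rewrite ltnNge vu.
(* The new cycle follows the old one, except that it leaves [f v] by a detour through [v]. *)
have next x : fconnect (tree_perm (v :: s)) x (tree_perm s x).
  have [->|xv] := eqVneq x v; first by rewrite vfix connect0.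
  have [->|xf] := eqVneq x (f v).
    apply: (connect_trans (y := v)).
      by apply/connect1/eqP; rewrite tree_perm_cons tpermR vfix.
    by apply/connect1/eqP; rewrite tree_perm_cons tpermL.
  by apply/connect1/eqP; rewrite tree_perm_cons tpermD // eq_sym.
have sub : subrel (fconnect (tree_perm s)) (fconnect (tree_perm (v :: s))).
  by apply: connect_sub => x y /eqP <-.
move=> u; rewrite inE => /predU1P[->|/IH /sub //].
rewrite fconnect_sym; last exact: perm_inj.
by apply/connect1/eqP; rewrite tree_perm_cons tpermR vfix.
Qed.

(** The order of the factors depends on [rank] alone, so when [f] varies with the input, the factor
    at [v] depends on it only through [f v]. *)
Definition tree_cycle : {perm V} := tree_perm (sort (relpre rank leq) (enum V)).

Lemma tree_cycle_iter v k : fconnect tree_cycle v (iter k f v).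
Proof.
elim: k => [|k IH] /=; first exact: connect0.
apply: (connect_trans IH); apply: tree_perm_connect.
- by apply: sort_sorted => a b; apply: leq_total.
- by rewrite sort_uniq enum_uniq.
- by rewrite mem_sort mem_enum.
Qed.

(** The orbit of [v] contains its root by [tree_cycle_iter] and stays in its tree by invariance of
    the root map. Accepting vertices are roots, so the orbit meets one exactly when the root of [v]
    accepts. *)
Lemma tree_cycle_reach (acc : pred V) (v : V) N :
  {in acc, forall u, f u = u} -> (forall u, f (iter N f u) = iter N f u) ->
  [exists k : 'I_#|V|, acc (iter k tree_cycle v)] = acc (iter N f v).
Proof.
move=> fix_acc fixN; apply/existsP/idP => [[k]|accN].
  set u := iter k _ v => accu.
  have fNu : iter N f u = u by elim: N {fixN} => //= N ->; apply: fix_acc.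
  have inv w : iter N f (tree_cycle w) = iter N f w.
    by apply: tree_perm_invariant => u'; rewrite -iterSr iterS fixN.
  suff <- : iter N f u = iter N f v by rewrite fNu.
  by rewrite {fNu accu}/u; elim: (k : nat) => //= j <-; rewrite inv.
have/iter_findex e := tree_cycle_iter v N.
have lt : findex tree_cycle v (iter N f v) < #|V|.
  apply: leq_trans (findex_max (tree_cycle_iter v N)) _; exact: max_card.
by exists (Ordinal lt); rewrite /= e.
Qed.

End TreeCycle.

Lemma local_product_tree_cycle n (V : finType) (F : n.-tuple bool -> V -> V)
    (rank : V -> nat) :
  (forall v, local (fun x => F x v)) ->
  local_product [set: {perm V}]%G #|V| (fun x => tree_cycle (F x) rank).
Proof.
move=> lF; have -> : #|V| = size (sort (relpre rank leq) (enum V)) * 1.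
  by rewrite size_sort muln1 cardE.
apply: local_product_prod => v _; apply: local_product_local => [x|].
  by rewrite inE.
exact: local_comp (lF v).
Qed.

(** * A controlled involution *)

Section Gadget.

Variables (n : nat) (V : finType) (F : n.-tuple bool -> V -> V).
Variables (rank : V -> nat) (acc : pred V) (s : V) (N : nat).

(* A point of the tree, a counter of visits to accepting roots, and two
   payload bits. *)
Definition core : finType := (V * 'I_#|V|.+1 * (bool * bool))%type.

Implicit Types (u : core) (p : {perm V}).

Definition move_fun p u : core :=
  let: (v, z, w) := u in (p v, z, w).

Lemma move_inj p : injective (move_fun p).
Proof. by move=> [[v z] w] [[v' z'] w'] [/perm_inj -> -> ->]. Qed.

Definition move_perm p : {perm core} := perm (@move_inj p).

Lemma move_permM : {morph move_perm : p q / (p * q)%g}.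
Proof.
by move=> p q; apply/permP => -[[v z] w]; rewrite permM !permE /= permM.
Qed.

Definition tick_fun u : core :=
  let: (v, z, w) := u in (v, if acc v then ordS z else z, w).

Lemma tick_inj : injective tick_fun.
Proof.
move=> [[v z] w] [[v' z'] w'] [-> + ->].
by case: ifP => _ => [/ordS_inj|] ->.
Qed.

Definition flip_fun u : core :=
  let: (v, z, (y, a)) := u in (v, z, (y (+) (a && (z != ord0)), a)).

Lemma flip_inj : injective flip_fun.
Proof.
move=> [[v z] [y a]] [[v' z'] [y' a']] [-> -> e ea].
by move: e; rewrite ea => /addIb ->.
Qed.

Definition mark_fun u : core :=
  let: (v, z, (y, a)) := u in (v, z, (y, a (+) ((v, z) == (s, ord0)))).

Lemma mark_inj : injective mark_fun.
Proof.
by move=> [[v z] [y a]] [[v' z'] [y' a']] [-> -> ->] /addIb ->.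
Qed.

Definition target_fun u : core :=
  let: (v, z, (y, a)) := u in (v, z, (y (+) ((v, z) == (s, ord0)), a)).

Lemma target_inj : injective target_fun.
Proof.
by move=> [[v z] [y a]] [[v' z'] [y' a']] [-> -> /addIb -> ->].
Qed.

Definition tick : {perm core} := perm tick_inj.
Definition flip : {perm core} := perm flip_inj.
Definition mark : {perm core} := perm mark_inj.
Definition target : {perm core} := perm target_inj.

Definition search p : {perm core} := ((tick * move_perm p) ^+ #|V|)%g.

(* [probe p] adds the second payload bit to the first where the search meets
   an accepting root, and [mark] flips the second bit at the start; both are
   involutions, so [gadget p] is their commutator. *)
Definition probe p : {perm core} := (search p * flip * (search p)^-1)%g.

Definition gadget p : {perm core} := (probe p * mark * (probe p * mark))%g.

Lemma search_frame p v z : exists vz, forall w, search p (v, z, w) = (vz, w).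
Proof.
suff H : forall k, exists vz, forall w, ((tick * move_perm p) ^+ k)%g (v, z, w) = (vz, w).
  exact: (H #|V|).
move=> k; elim: k v z => [|k IH] v z.
  by exists (v, z) => w; rewrite expg0 perm1.
have [vz e] := IH (p v) (if acc v then ordS z else z).
by exists vz => w; rewrite expgS permM permM !permE /= e.
Qed.

Lemma search_count p : exists z : 'I_#|V|.+1,
  (z = \sum_(i < #|V|) acc (iter i p s) :> nat) /\
  forall w, search p (s, ord0, w) = (iter #|V| p s, z, w).
Proof.
suff H : forall k, k <= #|V| -> exists z : 'I_#|V|.+1,
    (z = \sum_(i < k) acc (iter i p s) :> nat) /\
    forall w, ((tick * move_perm p) ^+ k)%g (s, ord0, w) = (iter k p s, z, w).
  exact: (H #|V|).
elim=> [_|k IH kV].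
  by exists ord0; rewrite big_ord0; split=> // w; rewrite perm1.
have [z [zE e]] := IH (ltnW kV).
exists (if acc (iter k p s) then ordS z else z); split=> [|w].
  rewrite big_ord_recr /= -zE; case: (acc _); rewrite ?addn0 ?addn1 //=.
  (* At most [#|V|] visits are counted modulo [#|V|.+1], so the counter never wraps around. *)
  rewrite modn_small // ltnS zE (leq_trans _ kV) // ltnS.
  by rewrite -[X in _ <= X](card_ord k) -sum1_card leq_sum // => i _; case: (acc _).
by rewrite expgSr permM e permM !permE.
Qed.

Lemma probeE p v z y a :
  probe p (v, z, (y, a)) =
  (v, z, (y (+) (a && ((search p (v, z, (false, false))).1.2 != ord0)), a)).
Proof.
have [[v' z'] e] := search_frame p v z.
by rewrite !permM !e [flip _]permE /= -e permK.
Qed.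

(** Let [c] be the outcome of the search and [m] the indicator of the start. The two rounds add
    [a c] and [(a + m) c] to [y], in total [m c], and add [m] twice to [a]. *)
Lemma gadgetE p : gadget p =
  if [exists k : 'I_#|V|, acc (iter k p s)] then target else 1%g.
Proof.
have [z [zE e]] := search_count p.
have -> : [exists k : 'I_#|V|, acc (iter k p s)] = (z != ord0).
  rewrite -val_eqE /= zE sum_nat_eq0; apply/existsP/forallPn => -[k] h; exists k.
    by rewrite h.
  by move: h; case: (acc _).
apply/permP => -[[v z'] [y a]].
have half (u1 : V) (u2 : 'I_#|V|.+1) (b c : bool) : (probe p * mark)%g (u1, u2, (b, c)) =
    (u1, u2, (b (+) (c && ((search p (u1, u2, (false, false))).1.2 != ord0)),
       c (+) ((u1, u2) == (s, ord0)))).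
  by rewrite permM probeE permE.
rewrite /gadget permM !half addbK.
have [[-> ->]|ne] := eqVneq (v, z') (s, ord0).
  rewrite e /=; case: (z != ord0); rewrite ?perm1 ?permE /= ?eqxx.
    by case: y; case: a.
  by rewrite !andbF !addbF.
case: ifP => _; rewrite ?perm1 ?permE /= ?(negbTE ne) addbF;
  by case: y; case: a; case: (_ != _).
Qed.

(** Each of the two halves has two searches of [#|V|] rounds with [#|V|.+1] factors, one [flip] and
    one [mark]. *)
Definition gadget_length : nat := 4 * (#|V| * #|V|.+1) + 4.

Lemma local_product_gadget :
  (forall v, local (fun x => F x v)) ->
  local_product [set: {perm core}]%G gadget_length
    (fun x => gadget (tree_cycle (F x) rank)).
Proof.
move=> lF.
have lconst (c : {perm core}) :
    local_product [set: {perm core}]%G 1 (fun _ : n.-tuple bool => c).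
  by apply: local_product_local => [x|]; [rewrite inE | apply: local_const].
have lmove : local_product [set: {perm core}]%G #|V|
    (fun x => move_perm (tree_cycle (F x) rank)).
  apply: local_product_morph (local_product_tree_cycle rank lF).
    exact: move_permM.
  by move=> a; rewrite inE.
have lsearch := local_product_exp #|V| (local_product_mul (lconst tick) lmove).
have lprobe := local_product_mul (local_product_mul lsearch (lconst flip))
                 (local_product_inv lsearch).
have lhalf := local_product_mul lprobe (lconst mark).
apply: local_product_leq (local_product_mul lhalf lhalf).
by rewrite /gadget_length; lia.
Qed.

Lemma gadget_tree_cycle (f : V -> V) :
  (forall v, f v != v -> rank v < rank (f v)) ->
  {in acc, forall v, f v = v} -> (forall v, f (iter N f v) = iter N f v) ->
  gadget (tree_cycle f rank) = if acc (iter N f s) then target else 1%g.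
Proof.
by move=> rf fa fN; rewrite gadgetE (tree_cycle_reach rf s fa fN).
Qed.

End Gadget.
(** * Even permutations as short products of involutions with many transpositions *)

Section Extension.

Variables (D G T : finType) (iota : D * G -> T).
Hypothesis iota_inj : injective iota.

Definition ext_fun (p : {perm D}) (t : T) : T :=
  if [pick c | iota c == t] is Some c then iota (p c.1, c.2) else t.

Lemma ext_fun_in p d g : ext_fun p (iota (d, g)) = iota (p d, g).
Proof.
rewrite /ext_fun; case: pickP => [c /eqP/iota_inj -> //|/(_ (d, g))].
by rewrite eqxx.
Qed.

Lemma ext_fun_out p t : (forall c, iota c != t) -> ext_fun p t = t.
Proof. by rewrite /ext_fun; case: pickP => // c e /(_ c); rewrite e. Qed.

Lemma imageP_or t : (exists c, t = iota c) \/ (forall c, iota c != t).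
Proof.
case: (pickP (fun c => iota c == t)) => [c /eqP <-|ne]; first by left; exists c.
by right=> c; rewrite ne.
Qed.

Lemma ext_inj p : injective (ext_fun p).
Proof.
have K q : cancel (ext_fun q) (ext_fun q^-1%g).
  move=> t; case: (imageP_or t) => [[[d g] ->]|ne].
    by rewrite !ext_fun_in permK.
  by rewrite !ext_fun_out.
exact: can_inj (K p).
Qed.

Definition ext p : {perm T} := perm (@ext_inj p).

Lemma ext_in p d g : ext p (iota (d, g)) = iota (p d, g).
Proof. by rewrite permE ext_fun_in. Qed.

Lemma ext_out p t : (forall c, iota c != t) -> ext p t = t.
Proof. by move=> ne; rewrite permE ext_fun_out. Qed.

Lemma extM : {morph ext : p q / (p * q)%g}.
Proof.
move=> p q; apply/permP => t; rewrite permM.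
case: (imageP_or t) => [[[d g] ->]|ne]; last by rewrite !ext_out.
by rewrite !ext_in permM.
Qed.

Lemma ext1 : ext 1%g = 1%g.
Proof.
apply/permP => t; rewrite perm1.
case: (imageP_or t) => [[[d g] ->]|ne]; last by rewrite ext_out.
by rewrite ext_in perm1.
Qed.

End Extension.

Definition neg_perm : {perm bool} := perm negb_inj.

Lemma neg_permK : (neg_perm * neg_perm = 1)%g.
Proof. by apply/permP => x; rewrite permM !permE /= negbK. Qed.

(* The two halves of [ext p] are conjugate, so they have the same parity. *)
Lemma ext_Alt (D E T : finType) (iota : D * (E * bool) -> T)
    (iota_inj : injective iota) p : ext iota_inj p \in ('Alt_T)%g.
Proof.
pose half b (c : D * E) := iota (c.1, (c.2, b)).
have half_inj b : injective (half b).
  by move=> [d e] [d' e'] /iota_inj [-> ->].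
pose flip (c : bool * (D * E)) := half c.1 c.2.
have flip_inj : injective flip.
  by move=> [b [d e]] [b' [d' e']] /iota_inj [-> -> ->].
pose c := ext flip_inj neg_perm.
have cE d e b : c (iota (d, (e, b))) = iota (d, (e, ~~ b)).
  by rewrite -[iota (d, (e, b))]/(flip (b, (d, e))) ext_in permE.
have cK t : c (c t) = t.
  case: (imageP_or flip t) => [[[b [d e]] ->]|ne].
    by rewrite /flip /half /= !cE negbK.
  by rewrite /c !ext_out.
have cV : (c^-1)%g = c.
  by apply/permP => t; apply: (@perm_inj _ c); rewrite permKV cK.
suff -> : ext iota_inj p =
    (ext (half_inj false) p * (ext (half_inj false) p) ^ c)%g.
  by rewrite Alt_even odd_permM odd_permJ addbb.
have half_out t b : (forall c, iota c != t) -> forall c, half b c != t.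
  by move=> ne [d e]; apply: ne.
have half0 d e : ext (half_inj false) p (iota (d, (e, false))) =
    iota (p d, (e, false)).
  by rewrite -[iota (d, (e, false))]/(half false (d, e)) ext_in.
have half1 d e : ext (half_inj false) p (iota (d, (e, true))) =
    iota (d, (e, true)).
  rewrite ext_out // => -[d' e'].
  by apply/eqP => /iota_inj.
apply/permP => t; rewrite permM conjgE permM cV permM.
case: (imageP_or iota t) => [[[d [e b]] ->]|ne].
  by case: b; rewrite ext_in ?half1 ?half0 cE /= ?half0 ?half1 cE.
have ct : c t = t by rewrite /c ext_out // => -[b [d e]]; apply: ne.
have et : ext (half_inj false) p t = t by rewrite ext_out //; apply: half_out.
by rewrite ext_out // et ct et ct.
Qed.

Lemma inject_set (A T : finType) (P : {set A}) (S : {set T}) (t0 : T) :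
  #|P| <= #|S| ->
  exists r : A -> T, {in P &, injective r} /\ {in P, forall a, r a \in S}.
Proof.
move=> PS; have ltP a : a \in P -> index a (enum P) < size (enum S).
  by move=> aP; rewrite -cardE (leq_trans _ PS) // cardE index_mem mem_enum.
exists (fun a => nth t0 (enum S) (index a (enum P))); split=> [a b aP bP /eqP|a aP].
  rewrite nth_uniq ?ltP ?enum_uniq // => /eqP e.
  by apply: (index_inj a) e; rewrite mem_enum.
by rewrite -mem_enum mem_nth ?ltP.
Qed.

(** Used to place copies of the gadget in [T] so that the points they swap are prescribed ones. The
    complement of the image of [inc] fits into that of [j] by counting. *)
Lemma extend_injection (A B T : finType) (inc : B -> A) (j : B -> T) (t0 : T) :
  injective inc -> injective j -> #|A| <= #|T| ->
  exists2 iota : A -> T, injective iota & forall b, iota (inc b) = j b.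
Proof.
move=> inc_inj j_inj AT.
pose P := ~: [set inc b | b : B]; pose S := ~: [set j b | b : B].
have PS : #|P| <= #|S|.
  have := cardsC [set inc b | b : B]; have := cardsC [set j b | b : B].
  by rewrite -/P -/S !card_imset //; lia.
have [r [r_inj rS]] := inject_set t0 PS.
pose iota a := if [pick b | inc b == a] is Some b then j b else r a.
have iota_inc b : iota (inc b) = j b.
  by rewrite /iota; case: pickP => [b' /eqP/inc_inj -> //|/(_ b)]; rewrite eqxx.
have iotaP a : (exists b, a = inc b) \/ (a \in P /\ iota a = r a).
  rewrite /iota; case: pickP => [b /eqP <-|ne]; first by left; exists b.
  right; split=> //; rewrite inE; apply/imsetP => -[b _ ab].
  by have := ne b; rewrite ab eqxx.
have jS b : j b \notin S by rewrite inE negbK imset_f.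
exists iota => // a a'.
case: (iotaP a) => [[b ->]|[aP ->]]; case: (iotaP a') => [[b' ->]|[aP' ->]].
- by rewrite !iota_inc => /j_inj ->.
- by rewrite iota_inc => e; have := jS b; rewrite e rS.
- by rewrite iota_inc => e; have := jS b'; rewrite -e rS.
- exact: r_inj.
Qed.

Section Decomposition.

Variables (T Q : finType) (q0 : Q).

(** These are the products of [#|Q|] disjoint transpositions, [j] listing the pairs. *)
Definition block_swap (b : {perm T}) : Prop :=
  exists (j : bool * Q -> T) (j_inj : injective j), b = ext j_inj neg_perm.

Definition moved (a : {perm T}) : {set T} := [set x | a x != x].

(** Greedy choice: a new point must avoid [U], its image and its preimage, at most [3 * #|U|]
    points. *)
Lemma disjoint_image (a : {perm T}) k : 3 * k <= #|moved a| ->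
  exists U : {set T},
    [/\ #|U| = k, U \subset moved a & [disjoint U & a @: U]].
Proof.
elim: k => [_|k IH lek].
  by exists set0; rewrite cards0 sub0set -setI_eq0 set0I.
have [|U [cU sU dU]] := IH; first by lia.
pose X := U :|: a @: U :|: a @^-1: U.
have cX : #|X| <= 3 * k.
  have c1 : #|a @: U| = k by rewrite card_imset //; apply: perm_inj.
  have c2 : #|a @^-1: U| = k.
    rewrite on_card_preimset // -?cU //.
    by apply: onW_bij; exists (a^-1%g); [apply: permK | apply: permKV].
  have := leq_card_setU (U :|: a @: U) (a @^-1: U).
  have := leq_card_setU U (a @: U).
  by rewrite cU c1 c2 -/X; case=> + _ [+ _]; lia.
have [u uM uX] : exists2 u, u \in moved a & u \notin X.
  by apply/subsetPn; apply/negP => /subset_leq_card; lia.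
move: uX; rewrite !inE !negb_or => /andP[/andP[uU uaU] auU].
exists (u |: U); split.
- by rewrite cardsU1 uU cU.
- by rewrite subUset sub1set uM.
rewrite imsetU1 -setI_eq0; apply/eqP/setP => x; rewrite !inE.
apply/negP => /andP[/predU1P[->|xU] /predU1P[e|xaU]].
- by move: uM; rewrite inE -e eqxx.
- by rewrite xaU in uaU.
- by rewrite -e xU in auU.
- by have /pred0P/(_ x) := dU; rewrite /= xU xaU.
Qed.

(* For [b] swapping each [u] in [U] with [a u], the product [a * b] fixes [U]. *)
Lemma block_swap_reduce (a : {perm T}) : 3 * #|Q| <= #|moved a| ->
  exists2 b, block_swap b & #|moved (a * b)%g| + #|Q| <= #|moved a|.
Proof.
move=> /disjoint_image [U [cU sU dU]].
have /card_gt0P [t0 _] : 0 < #|U| by rewrite cU; apply/card_gt0P; exists q0.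
have [|r [r_inj rU]] := @inject_set Q T [set: Q] U t0; first by rewrite cardsT cU.
have {}r_inj : injective r by move=> q q'; apply: r_inj; rewrite inE.
have {}rU q : r q \in U by apply: rU; rewrite inE.
pose j (c : bool * Q) := if c.1 then a (r c.2) else r c.2.
have ne q q' : a (r q) != r q'.
  apply/eqP => e; have /pred0P/(_ (r q')) := dU.
  by rewrite /= rU -e imset_f.
have j_inj : injective j.
  move=> [[] q] [[] q'] /=; rewrite /j /=.
  - by move/perm_inj/r_inj ->.
  - by move/eqP; rewrite (negbTE (ne _ _)).
  - by move/esym/eqP; rewrite (negbTE (ne _ _)).
  - by move/r_inj ->.
exists (ext j_inj neg_perm); first by exists j, j_inj.
have UE : U = r @: [set: Q].
  apply/esym/eqP; rewrite eqEcard; apply/andP; split.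
    by apply/subsetP => x /imsetP[q _ ->].
  by rewrite card_imset // cardsT cU.
suff sub : moved (a * ext j_inj neg_perm)%g \subset moved a :\: U.
  have := subset_leq_card sub; rewrite cardsD (setIidPr sU) cU.
  have := subset_leq_card sU; rewrite cU; lia.
apply/subsetP => x; rewrite !inE permM => mx; apply/andP; split.
  apply: contraNN mx; rewrite UE => /imsetP[q _ ->].
  by rewrite -[a (r q)]/(j (true, q)) ext_in permE.
apply: contraNN mx => /eqP ax; rewrite ax ext_out // => -[b q].
have rm : a (r q) != r q by apply: ne.
by rewrite /j; case: b => /=; apply: contraNneq rm => e;
  [apply/eqP/(@perm_inj _ a); rewrite e ax | rewrite e ax].
Qed.

(* [j1] and [j2] agree outside [q0], so the remaining transpositions cancel. *)
Lemma two_tperm (a b c d : T) : a != b -> c != d -> 2 * #|Q| + 4 <= #|T| ->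
  exists b1 b2, [/\ block_swap b1, block_swap b2 &
    (tperm a b * tperm c d = b1 * b2)%g].
Proof.
move=> ab cd leT; pose S := ~: [set a; b; c; d].
have cS : #|[set: bool * Q]| <= #|S|.
  rewrite cardsT card_prod card_bool; have := cardsC [set a; b; c; d].
  rewrite -/S.
  suff : #|[set a; b; c; d]| <= 4 by lia.
  rewrite -!setUA; do 3![apply: leq_trans (leq_of_leqif (leq_card_setU _ _)) _;
    rewrite cards1 add1n ltnS]; by rewrite cards1.
have [r [r_inj rS]] := inject_set a cS.
have {}r_inj : injective r by move=> q q'; apply: r_inj; rewrite inE.
have {}rS q : r q \in S by apply: rS; rewrite inE.
pose j u v (x : bool * Q) := if x.2 == q0 then if x.1 then v else u else r x.
have j_inj u v : u != v -> u \notin S -> v \notin S -> injective (j u v).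
  move=> uv uS vS.
  have nu q : r q != u by apply: contraNneq uS => <-.
  have nv q : r q != v by apply: contraNneq vS => <-.
  move=> [x q] [x' q']; rewrite /j /=.
  case: (eqVneq q q0) => [->|_]; case: (eqVneq q' q0) => [->|_].
  - by case: x; case: x' => // /eqP; rewrite ?(negbTE uv) // eq_sym (negbTE uv).
  - by move/esym/eqP; case: x; rewrite ?(negbTE (nu _)) ?(negbTE (nv _)).
  - by move/eqP; case: x'; rewrite ?(negbTE (nu _)) ?(negbTE (nv _)).
  - by move/r_inj.
(* The right-hand side does not mention [u] and [v]; comparing two instances gives [e12]. *)
have swE u v (uv : u != v) (uS : u \notin S) (vS : v \notin S) t :
    (tperm u v * ext (j_inj u v uv uS vS) neg_perm)%g t =
    if [pick x | (x.2 != q0) && (r x == t)] is Some x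
    then r (~~ x.1, x.2) else t.
  rewrite permM; case: pickP => [[x q] /= /andP[qq /eqP <-]|no].
    rewrite tpermD; last first.
    - by apply: contraNneq vS => ->.
    - by apply: contraNneq uS => ->.
    have e y : r (y, q) = j u v (y, q) by rewrite /j /= (negbTE qq).
    by rewrite e ext_in permE -e.
  have ju : u = j u v (false, q0) by rewrite /j eqxx.
  have jv : v = j u v (true, q0) by rewrite /j eqxx.
  case: tpermP => [->|->|/eqP tu /eqP tv].
  - by have := ext_in (j_inj u v uv uS vS) neg_perm true q0; rewrite [neg_perm _]permE -ju -jv.
  - by have := ext_in (j_inj u v uv uS vS) neg_perm false q0; rewrite [neg_perm _]permE -ju -jv.
  rewrite ext_out // => -[x q]; rewrite /j /=.
  case: (eqVneq q q0) => [_|qq]; first by case: x; rewrite eq_sym.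
  by apply/negP => e; have := no (x, q); rewrite qq e.
have aS : a \notin S by rewrite !inE eqxx.
have bS : b \notin S by rewrite !inE eqxx ?orbT.
have cS' : c \notin S by rewrite !inE eqxx ?orbT.
have dS : d \notin S by rewrite !inE eqxx ?orbT.
pose b1 := ext (j_inj a b ab aS bS) neg_perm.
pose b2 := ext (j_inj c d cd cS' dS) neg_perm.
have e12 : (tperm a b * b1 = tperm c d * b2)%g.
  by apply/permP => t; rewrite !swE.
have b2K : (b2 * b2 = 1)%g.
  by rewrite -extM neg_permK ext1.
exists b1, b2; split; first by exists (j a b), (j_inj a b ab aS bS).
  by exists (j c d), (j_inj c d cd cS' dS).
have -> : b1 = (tperm a b * (tperm c d * b2))%g by rewrite -e12 mulgA tperm2 mul1g.
by rewrite -!mulgA b2K mulg1.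
Qed.

Lemma moved_gt0 (a : {perm T}) : a != 1%g -> exists x, a x != x.
Proof.
move=> a1; case: (pickP (fun x => a x != x)) => [x ax|no]; first by exists x.
case/negP: a1; apply/eqP/permP => x; rewrite perm1.
by apply/eqP; rewrite -[_ == _]negbK no.
Qed.

Lemma moved_tperm (a : {perm T}) x : a x != x ->
  #|moved (a * tperm x (a x))%g| < #|moved a|.
Proof.
move=> ax; apply: proper_card; apply/properP; split.
  apply/subsetP => y; rewrite !inE permM; apply: contraNN => /eqP ay.
  rewrite ay tpermD //; first by apply: contraNneq ax => ->; rewrite ay.
  by apply: contraNneq ax => e; rewrite e -(perm_inj (etrans e (esym ay))).
by exists x; rewrite !inE ?permM ?tpermR ?eqxx.
Qed.

(** Transpositions are split off two at a time. Each one lowers the number of moved points, and a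
    pair costs two block swaps. *)
Lemma block_swaps_small (a : {perm T}) : 2 * #|Q| + 4 <= #|T| ->
  a \in ('Alt_T)%g ->
  exists s, [/\ {in s, forall b, block_swap b}, size s <= #|moved a|
    & a = (\prod_(b <- s) b)%g].
Proof.
move=> leT; have [m] := ubnP #|moved a|; elim: m a => [//|m IH] a lem evena.
have [->|/moved_gt0 [x ax]] := eqVneq a 1%g.
  by exists [::]; rewrite big_nil.
pose a1 := (a * tperm x (a x))%g.
have odda1 : odd_perm a1.
  by rewrite odd_permM odd_tperm eq_sym ax addbT -Alt_even.
(* An odd permutation is not the identity, so a second transposition can be split off. *)
have [|y ay] := @moved_gt0 a1.
  by apply: contraTneq odda1 => ->; rewrite odd_perm1.
pose a2 := (a1 * tperm y (a1 y))%g.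
have lt1 := moved_tperm ax; have lt2 := moved_tperm ay.
rewrite -/a1 -/a2 in lt1 lt2.
have [||s [sw les ea2]] := IH a2; first by lia.
  by rewrite Alt_even odd_permM odd_tperm [y == _]eq_sym ay odda1.
have yne : y != a1 y by rewrite eq_sym.
have xne : x != a x by rewrite eq_sym.
have [b1 [b2 [sw1 sw2 e12]]] := two_tperm yne xne leT.
exists (s ++ [:: b1; b2]); split.
- move=> b; rewrite mem_cat !inE => /or3P[/sw //|/eqP ->|/eqP ->] //.
- by rewrite size_cat; apply: leq_trans (leq_add les (leqnn 2)) _; lia.
rewrite big_cat /= -ea2 !big_cons big_nil mulg1 -e12 /a2.
by rewrite mulgA -[(a1 * _ * _)%g]mulgA tperm2 mulg1 /a1 -mulgA tperm2 mulg1.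
Qed.

(** While at least [3 * #|Q|] points move, one swap fixes [#|Q|] of them. The remainder takes fewer
    than [3 * #|Q|] swaps, which gives the quadratic term. *)
Lemma block_swaps (a : {perm T}) : 2 * #|Q| + 4 <= #|T| -> a \in ('Alt_T)%g ->
  (forall b, block_swap b -> b \in ('Alt_T)%g) ->
  exists s, [/\ {in s, forall b, block_swap b},
    #|Q| * size s <= #|T| + 3 * #|Q| ^ 2
    & a = (\prod_(b <- s) b)%g].
Proof.
move=> leT + swA; have q1 : 0 < #|Q| by apply/card_gt0P; exists q0.
suff H m : forall a, #|moved a| < m -> a \in ('Alt_T)%g ->
   exists s, [/\ {in s, forall b, block_swap b},
    #|Q| * size s <= #|moved a| + 3 * #|Q| ^ 2
    & a = (\prod_(b <- s) b)%g].
  move=> evena; have [s [sw les e]] := H _ a (ltnSn _) evena.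
  by exists s; split=> //; apply: leq_trans les _; rewrite leq_add2r max_card.
elim: m {a} => // m IH a lem evena.
have [lt|/block_swap_reduce [b swb redb]] := ltnP #|moved a| (3 * #|Q|).
  have [s [sw les e]] := block_swaps_small leT evena.
  exists s; split=> //; apply: leq_trans (leq_mul (leqnn _) les) _.
  by rewrite -mulnn; nia.
have [||s [sw les e]] := IH (a * b)%g; first by lia.
  exact: groupM evena (swA _ swb).
have bb : (b * b = 1)%g.
  by have [j [j_inj ->]] := swb; rewrite -extM neg_permK ext1.
exists (s ++ [:: b]); split.
- by move=> c; rewrite mem_cat inE => /orP[/sw //|/eqP ->].
- rewrite size_cat mulnDr; apply: leq_trans (leq_add les (leqnn _)) _.
  by rewrite muln1; lia.
by rewrite big_cat /= -e big_cons big_nil mulg1 -mulgA bb mulg1.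
Qed.

End Decomposition.

Section Controlled.

Variables (n : nat) (V : finType) (F : n.-tuple bool -> V -> V).
Variables (rank : V -> nat) (acc : pred V) (s : V) (N : nat).
Hypothesis F_local : forall v, local (fun x => F x v).
Hypothesis rank_F : forall x v, F x v != v -> rank v < rank (F x v).
Hypothesis acc_fix : forall x, {in acc, forall v, F x v = v}.
Hypothesis iter_fix : forall x v, F x (iter N (F x) v) = iter N (F x) v.

Let L := gadget_length V.

Lemma local_product_controlled (T E : finType) (e0 : E) (a : {perm T}) :
  #|core V| * (2 * #|E|) <= #|T| -> 8 * #|E| + 4 <= #|T| -> a \in ('Alt_T)%g ->
  exists m, 4 * #|E| * m <= #|T| + 3 * (4 * #|E|) ^ 2 /\
    local_product ('Alt_T)%g (m * L)
      (fun x => if acc (iter N (F x) s) then a else 1%g).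
Proof.
(* [target] swaps two pairs, one for each value of the second payload bit. There are [2 * #|E|]
   copies, the factor 2 being what [ext_Alt] needs for evenness. *)
move=> leT1 leT2 evena; pose Q := ((bool * E) * bool)%type.
have cQ : #|{: Q}| = 4 * #|E| by rewrite !card_prod card_bool; lia.
have [||b [sw les ea]] := @block_swaps T Q ((false, e0), false) a _ evena.
- by rewrite cQ; lia.
- by move=> b [j [j_inj ->]]; apply: ext_Alt.
exists (size b); rewrite -cQ; split=> //.
have step c : block_swap Q c -> local_product ('Alt_T)%g L
    (fun x => if acc (iter N (F x) s) then c else 1%g).
  move=> [j [j_inj ->]].
  (* Lists the pairs that [target] swaps in all copies; matching them with [j] turns the extended
     [target] into the given block swap. *)
  pose inc (y : bool * Q) : core V * (E * bool) :=
    ((s, ord0, (y.1, y.2.1.1)), (y.2.1.2, y.2.2)).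
  have inc_inj : injective inc.
    by move=> [y [[u e] v]] [y' [[u' e'] v']] [-> -> -> ->].
  have cA : #|{: core V * (E * bool)}| <= #|T|.
    have cE : #|{: E * bool}| = 2 * #|E| by rewrite card_prod card_bool mulnC.
    by rewrite card_prod cE.
  have [iota iota_inj iotaE] :=
    extend_injection (j (false, (false, e0, false))) inc_inj j_inj cA.
  have lG := local_product_gadget rank acc s F_local.
  apply: local_product_eq (local_product_morph (extM iota_inj)
    (ext_Alt iota_inj) lG) => x.
  rewrite (gadget_tree_cycle s (@rank_F x) (@acc_fix x) (@iter_fix x)).
  case: ifP => _; last exact: ext1.
  apply/permP => t; case: (imageP_or j t) => [[[y [[u e] v]] ->]|nj].
    rewrite [in RHS]ext_in [neg_perm _]permE -!iotaE /inc /= ext_in.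
    by rewrite [target _ _]permE /= eqxx addbT.
  rewrite [in RHS]ext_out //.
  case: (imageP_or iota t) => [[[[[w z] [y u]] [e v]] it]|ni]; last by rewrite ext_out.
  rewrite it ext_in [target _ _]permE /=; case: eqP => [[wE zE]|_]; last by rewrite addbF.
  by have := nj (y, (u, e, v)); rewrite -iotaE /inc /= it wE zE eqxx.
apply: local_product_eq (@local_product_prod _ _ _ _ b L
  (fun c x => if acc (iter N (F x) s) then c else 1%g) _) => [x|c cb].
  by case: ifP => _; [rewrite -ea | rewrite big1_eq].
exact/step/sw.
Qed.

End Controlled.

(** * Machines as forests of configurations *)

Section Configurations.

Variables (M : machine) (n : nat) (a : seq bool) (S : nat).

Definition fconfig : finType :=
  (state M * 'I_n.+2 * 'I_(size a).+2 * 'I_S.+1 *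
     {ffun 'I_S.+1 -> work_symbol M})%type.

Implicit Types (d : fconfig) (x : n.-tuple bool) (c : config M).

Definition fconfig_state d : state M := d.1.1.1.1.

(** The scanned symbol is an argument, so the input enters only through [r]; head moves need only
    its length, hence the dummy input [nseq n false]. *)
Definition fconfig_step (r : ro_symbol) d : fconfig :=
  let: (q, p, h, w, t) := d in
  if (q == accept M) || (q == reject M) then d else
  let: (q', g, (mi, ma, mw)) := delta q r (nth RightEnd (ro_tape a) h) (t w) in
  (q', inord (ro_move (nseq n false) mi p), inord (ro_move a ma h),
   inord (work_move mw w), [ffun i => if i == w then g else t i]).

Definition fstep x d : fconfig :=
  fconfig_step (nth RightEnd (ro_tape x) d.1.1.1.2) d.

Definition fconfig_start : fconfig :=
  (start M, ord0, ord0, ord0, [ffun=> blank M]).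

Definition represents c d : Prop :=
  let: (q, p, h, w, t) := d in
  [/\ cstate c = q, input_head c = p, advice_head c = h &
    work_head c = w /\ forall i : 'I_S.+1, work_tape c i = t i].

Lemma ro_move_leq s m p : p <= (size s).+1 -> ro_move s m p <= (size s).+1.
Proof. by case: m => //= h; lia. Qed.

Lemma represents_step x c d : represents c d ->
  work_head (step x a c) <= S -> represents (step x a c) (fstep x d).
Proof.
case: d => [[[[q p] h] w] t]; case: c => q' p' h' w' t'.
rewrite /represents /= => -[-> -> -> [-> tE]].
rewrite /step /fstep /=; case: ifP => // _.
rewrite tE; case: (delta _ _ _ _) => [[q1 g] [[mi ma] mw]] /= wS.
have mE : ro_move (nseq n false) mi p = ro_move x mi p.
  by case: mi => //=; rewrite size_nseq size_tuple.
rewrite mE !inordK ?ltnS //; last 2 first.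
- by apply: ro_move_leq; rewrite -ltnS ltn_ord.
- by rewrite -[X in _ <= X.+1](size_tuple x) ro_move_leq // size_tuple -ltnS ltn_ord.
by split=> //; split=> // i; rewrite ffunE -val_eqE; case: eqP.
Qed.

Lemma represents_run x k : (forall j, work_head (run M x a j) <= S) ->
  represents (run M x a k) (iter k (fstep x) fconfig_start).
Proof.
move=> leS; elim: k => [|k IH].
  by split=> //; split=> // i; rewrite ffunE.
by rewrite /run !iterS; apply: represents_step => //; apply: (leS k.+1).
Qed.

Lemma represents_state c d : represents c d -> fconfig_state d = cstate c.
Proof. by case: d => [[[[q p] h] w] t] []. Qed.

Lemma fstep_halt x d :
  (fconfig_state d == accept M) || (fconfig_state d == reject M) ->
  fstep x d = d.
Proof.
by case: d => [[[[q p] h] w] t]; rewrite /fstep /fconfig_state /= => ->.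
Qed.

Lemma local_fstep d : local (fun x => fstep x d).
Proof.
case: d => [[[[q p] h] w] t]; rewrite /fstep.
(* Tape cell [p] holds bit [p.-1], as cell 0 is the left marker. *)
exists p.-1 => x y e; congr fconfig_step => /=.
case: (val p) e => [//|i] /= e; rewrite !nth_rcons !size_map !size_tuple.
by case: ltnP => // li; rewrite !(nth_map false) ?size_tuple // e.
Qed.

(** Allows the unknown halting time to be replaced by the number of configurations. *)
Lemma iter_fixpoint (X : finType) (f : X -> X) (u : X) k :
  f (iter k f u) = iter k f u -> iter #|X| f u = iter k f u.
Proof.
move=> fk; have fu := fconnect_iter f k u.
have lt : findex f u (iter k f u) <= #|X|.
  by apply: ltnW (leq_trans (findex_max fu) _); apply: max_card.
rewrite -[LHS]/(iter _ f u) -(subnK lt) iterD iter_findex //.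
by elim: (_ - _) => //= m ->.
Qed.

Lemma fstep_decides adv A x : adv n = a ->
  decides_with_advice M adv A ->
  (forall j, work_head (run M x a j) <= S) ->
  A x <->
  fconfig_state (iter #|fconfig| (fstep x) fconfig_start) == accept M.
Proof.
move=> advE [nar /(_ x)]; rewrite size_tuple advE => -[Acc Rej] leS.
have haltE q : (q == accept M) || (q == reject M) ->
    (exists k, cstate (run M x a k) = q) ->
    fconfig_state (iter #|fconfig| (fstep x) fconfig_start) = q.
  move=> hq [k]; rewrite -(represents_state (represents_run k leS)) => e.
  by rewrite (iter_fixpoint (k := k)) // fstep_halt // e.
split=> [Ax|/eqP e]; first by rewrite (haltE _ _ (Acc Ax)) ?eqxx.
case: (classic (A x)) => // nA.
by move: nar; rewrite -e (haltE _ _ (Rej nA)) ?eqxx ?orbT.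
Qed.

(** The time coordinate is the rank: it grows along every edge, even where the machine loops, and
    the vertices of the last layer are the roots. *)
Definition layered : finType := (fconfig * 'I_#|fconfig|.+1)%type.

Definition layered_step x (v : layered) : layered :=
  if v.2 < #|fconfig| then (fstep x v.1, inord v.2.+1) else v.

Definition layered_accept (v : layered) : bool :=
  (v.2 == ord_max) && (fconfig_state v.1 == accept M).

Definition layered_start : layered := (fconfig_start, ord0).

Lemma local_layered_step v : local (fun x => layered_step x v).
Proof.
rewrite /layered_step; case: (v.2 < _); last exact: local_const.
exact: (local_comp (fun d => (d, inord v.2.+1))) (local_fstep v.1).
Qed.

Lemma layered_step_rank x v : layered_step x v != v ->
  v.2 < (layered_step x v).2.
Proof. by rewrite /layered_step; case: ifP => [lt _|_ /eqP //]; rewrite /= inordK. Qed.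

Lemma layered_accept_fix x :
  {in layered_accept, forall v, layered_step x v = v}.
Proof.
by move=> v /andP[/eqP e _]; rewrite /layered_step e ltnn.
Qed.

Lemma iter_layered_step2 x v k :
  (iter k (layered_step x) v).2 = minn #|fconfig| (v.2 + k) :> nat.
Proof.
elim: k => [|k IH].
  by rewrite addn0; apply/esym/minn_idPr; rewrite -ltnS.
have {IH} := IH; rewrite iterS; move: (iter k _ _) => u uE.
rewrite /layered_step.
case: ifP => [lt|]; last by lia.
by rewrite [LHS](@inordK #|fconfig| u.2.+1) //; lia.
Qed.

Lemma iter_layered_step_fix x v :
  let u := iter #|fconfig| (layered_step x) v in layered_step x u = u.
Proof.
by move=> u; rewrite /layered_step iter_layered_step2; case: ifP => //; lia.
Qed.

Lemma iter_layered_step1 x d k : k <= #|fconfig| ->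
  (iter k (layered_step x) (d, ord0)).1 = iter k (fstep x) d.
Proof.
elim: k => [//|k IH] lek; rewrite !iterS -(IH (ltnW lek)).
have := iter_layered_step2 x (d, ord0) k; rewrite add0n (minn_idPr (ltnW lek)).
by move: (iter k _ _) => u uk; rewrite /layered_step uk lek.
Qed.

Lemma layered_accept_iter x :
  layered_accept (iter #|fconfig| (layered_step x) layered_start) =
  (fconfig_state (iter #|fconfig| (fstep x) fconfig_start) == accept M).
Proof.
rewrite /layered_accept iter_layered_step1 // -val_eqE /= iter_layered_step2.
by rewrite add0n minnn eqxx.
Qed.

End Configurations.
(** * The two classes *)

(* [48 L^2] points, where [L] is [gadget_length]: the involutions consist of
   [h = 4 L] transpositions, and [(t + 3 h^2) / h] of them take at most [t]
   factors when [3 h^2 <= t]. *)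
Definition product_length (V : nat) : nat := 48 * (4 * (V * V.+1) + 4) ^ 2.

Lemma card_core (V : finType) : #|core V| = 4 * (#|V| * #|V|.+1).
Proof. by rewrite card_prod card_prod card_ord card_prod card_bool mulnC. Qed.

Section LpolyCircuits.

Variables (C : forall t : nat, circuit (perm_bit t)) (T : nat).
Hypothesis C_decides : forall t : nat, T <= t ->
  exists2 alpha : {perm 'I_t}, alpha \in ('Alt_('I_t))%g &
    decides_product ('Alt_('I_t))%g alpha
      (fun x : 'I_t -> {perm 'I_t} => circuit_eval (C t) (pointwise x)).

(** The circuit is fed a product equal to [alpha] or 1 according to acceptance. Each bit of its
    input depends on one bit of [x], so substituting formulas for its leaves adds at most one
    level. *)
Lemma formula_of_machine A M adv n S t :
  decides_with_advice M adv A ->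
  (forall (x : n.-tuple bool) k, work_head (run M x (adv n) k) <= S) ->
  T <= t -> product_length #|layered M n (adv n) S| <= t ->
  exists2 f : formula 'I_n, fdepth f <= (circuit_depth (C t)).+1 &
    forall x : n.-tuple bool, A x <-> feval (tnth x) f.
Proof.
move=> decA leS Tt; rewrite /product_length; set V := layered _ _ _ _.
have L_def : gadget_length V = 4 * (#|V| * #|V|.+1) + 4 by [].
rewrite -L_def; move: L_def; set L := gadget_length V => L_def leLt.
have [alpha alphaA dec] := C_decides Tt.
have L4 : 4 <= L by lia.
have L0 : 0 < L by lia.
have cardV : #|core V| = 4 * (#|V| * #|V|.+1).
  exact: card_core.
rewrite -mulnn in leLt.
have [||m [lem lprod]] := @local_product_controlled n V
    (@layered_step M n (adv n) S) (fun v => v.2) (@layered_accept M n (adv n) S)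
    (layered_start M n (adv n) S) #|fconfig M n (adv n) S|
    (@local_layered_step _ _ _ _) (@layered_step_rank _ _ _ _)
    (@layered_accept_fix _ _ _ _) (@iter_layered_step_fix _ _ _ _)
    'I_t 'I_L (Ordinal L0) alpha _ _ alphaA.
- by rewrite !card_ord cardV; nia.
- by rewrite !card_ord; nia.
rewrite !card_ord -/L -mulnn in lem lprod.
(* From [4 * L * m <= t + 48 * L ^ 2 <= 2 * t]. *)
have mLt : m * L <= t by nia.
have [phi [phi_local phiA phiE]] := local_product_leq mLt lprod.
have [f0 [<- f0E]] := formula_of_circuit (C t).
pose y x (i : 'I_t) := phi i x.
have leaf_ex (b : perm_bit t) : exists g : formula 'I_n,
    fdepth g <= 1 /\ forall x, feval (tnth x) g = pointwise (y x) b.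
  have bit_local : local (fun x => pointwise (y x) b).
    case: b => [[i j] k].
    exact: (local_comp (fun p : {perm 'I_t} => odd (p j %/ 2 ^ k))) (phi_local i).
  by have [g dg gE] := local_formula bit_local; exists g.
have [leaf leafP] := dependent_choice leaf_ex.
exists (fsubst leaf f0).
  by rewrite -addn1 fdepth_subst // => b; case: (leafP b).
move=> x; rewrite feval_subst.
rewrite (feval_ext _ (fun b => (leafP b).2 x)) f0E.
rewrite (fstep_decides (erefl (adv n)) decA (leS x)) -layered_accept_iter.
have [] := dec (y x) (fun i => phiA i x); rewrite -phiE.
by case: ifP => _ dec1 dec0; [rewrite dec1 | rewrite dec0].
Qed.

End LpolyCircuits.

(** * Growth of the parameters, and the converse inclusion *)

Lemma isO_log_poly f : poly_bounded f -> isO (fun n => log2 (f n)) log2.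
Proof.
(* For [n >= c] the value is at most [n ^ k.+1]; the factor 2 absorbs the rounding, as
   [(log2 n).+1 <= 2 * log2 n]. *)
move=> [k [c [N fk]]]; exists (2 * k.+1), (maxn N (maxn c 2)) => n nN.
have n2 : 1 < n by lia.
have log1 : 0 < log2 n by rewrite /log2 trunc_log_gt0.
have [->|f0] := posnP (f n); first by rewrite /log2 trunc_log0.
have lt : 2 ^ log2 (f n) < 2 ^ ((log2 n).+1 * k.+1).
  apply: leq_ltn_trans (trunc_logP _ f0) _ => //.
  apply: leq_ltn_trans (fk n _) _; first by lia.
  rewrite expnM; apply: (@leq_ltn_trans (n ^ k.+1)).
    by rewrite expnS leq_mul2r; lia.
  by rewrite ltn_exp2r // trunc_log_ltn.
by move: lt; rewrite ltn_exp2l //; nia.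
Qed.

Lemma poly_bounded_log : poly_bounded log2.
Proof.
apply: poly_bounded_le poly_bounded_id; exists 1 => n n1.
apply: ltnW; apply: leq_trans (ltn_expl _ (ltnSn 1)) _.
exact: trunc_logP.
Qed.

Lemma card_fconfig M n a S : #|fconfig M n a S| =
  #|state M| * n.+2 * (size a).+2 * S.+1 * #|work_symbol M| ^ S.+1.
Proof. by rewrite !card_prod card_ffun !card_ord. Qed.

Lemma poly_bounded_succ f : poly_bounded f -> poly_bounded (fun n => (f n).+1).
Proof.
move=> pf; apply: poly_bounded_le (poly_bounded_add pf (poly_bounded_const 1)).
by exists 0 => n _; rewrite addn1.
Qed.

Lemma poly_bounded_product_length M adv c :
  poly_bounded (fun n => size (adv n)) ->
  poly_bounded
    (fun n => product_length #|layered M n (adv n) (c * log2 n)|).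
Proof.
move=> padv.
have pX : poly_bounded (fun n => #|fconfig M n (adv n) (c * log2 n)|).
  apply: (@poly_bounded_le _ (fun n => #|state M| * n.+2 * (size (adv n)).+2 *
    (c * log2 n).+1 * (#|work_symbol M| * #|work_symbol M| ^ (c * log2 n)))).
    by exists 0 => n _; rewrite card_fconfig expnS.
  have G0 : 0 < #|work_symbol M| by apply/card_gt0P; exists (blank M).
  apply: poly_bounded_mul.
    apply: poly_bounded_mul; last first.
      exact/poly_bounded_succ/poly_bounded_mul/poly_bounded_log/poly_bounded_const.
    apply: poly_bounded_mul; last exact/poly_bounded_succ/poly_bounded_succ.
    apply: poly_bounded_mul (poly_bounded_const _) _.
    exact/poly_bounded_succ/poly_bounded_succ/poly_bounded_id.
  apply: poly_bounded_mul (poly_bounded_const _) _.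
  by apply: poly_bounded_exp_log => //; exists c, 0.
have pV : poly_bounded (fun n => #|layered M n (adv n) (c * log2 n)|).
  apply: poly_bounded_le (poly_bounded_mul pX (poly_bounded_succ pX)).
  by exists 0 => n _; rewrite card_prod card_ord.
apply: poly_bounded_mul (poly_bounded_const _) _.
apply: poly_bounded_exp; apply: poly_bounded_add (poly_bounded_const _).
apply: poly_bounded_mul (poly_bounded_const _) _.
exact: poly_bounded_mul pV (poly_bounded_succ pV).
Qed.

Lemma Lpoly_sub_NC1 (C : forall t : nat, circuit (perm_bit t)) (T : nat)
  (C_depth : isO (fun t => circuit_depth (C t)) log2)
  (C_decides : forall t : nat, T <= t ->
     exists2 alpha : {perm 'I_t}, alpha \in ('Alt_('I_t))%g &
       decides_product ('Alt_('I_t))%g alpha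
         (fun x : 'I_t -> {perm 'I_t} => circuit_eval (C t) (pointwise x))) A :
  Lpoly A -> NC1 A.
Proof.
move=> [M [adv [padv decA [c [N log_space]]]]].
have [c' [T' C_log]] := C_depth.
(* The summand [T + T'] brings both hypotheses on [C] into force at every [n]. *)
pose t n := product_length #|layered M n (adv n) (c * log2 n)| + (T + T').
have pt : poly_bounded t.
  exact: poly_bounded_add (poly_bounded_product_length _ _ padv)
    (poly_bounded_const _).
have exD n : exists D : circuit 'I_n,
    [/\ circuit_size D <= 2 ^ (circuit_depth D).+1,
        N <= n -> circuit_depth D <= (circuit_depth (C (t n))).+1
      & forall x : n.-tuple bool, A x <-> circuit_eval D (tnth x)].
  suff [f fd fA] : exists2 f : formula 'I_n,
      N <= n -> fdepth f <= (circuit_depth (C (t n))).+1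
      & forall x : n.-tuple bool, A x <-> feval (tnth x) f.
    have [D [sD dD eD]] := circuit_of_formula f.
    by exists D; rewrite dD; split=> // x; rewrite eD.
  have [Nn|nN] := leqP N n; last first.
    have [f fE] := formula_of_function (fun x : n.-tuple bool =>
      if excluded_middle_informative (A x) then true else false).
    by exists f => // x; rewrite fE; case: excluded_middle_informative.
  have leS (x : n.-tuple bool) k : work_head (run M x (adv n) k) <= c * log2 n.
    by have := log_space x; rewrite size_tuple => /(_ Nn k).
  have [||f fd fA] := @formula_of_machine C T C_decides A M adv n _ (t n) decA leS.
  - by rewrite /t; lia.
  - by rewrite /t leq_addr.
  by exists f.
have [D DP] := dependent_choice exD.
have depthD : isO (fun n => circuit_depth (D n)) log2.
  have [c1 [N1 log_t]] := isO_log_poly pt.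
  (* The additional 1 pays for the level of the substituted leaves, since [log2 n] is positive. *)
  exists (c' * c1 + 1), (maxn N (maxn N1 2)) => n nN.
  have [_ dD _] := DP n; have Nn : N <= n by lia.
  have log1 : 0 < log2 n by rewrite /log2 trunc_log_gt0; lia.
  have tT : T' <= t n by rewrite /t; lia.
  have le1 : log2 (t n) <= c1 * log2 n by apply: log_t; lia.
  apply: leq_trans (dD Nn) _; rewrite mulnDl mul1n -addn1 leq_add //.
  by apply: leq_trans (C_log _ tT) _; rewrite -mulnA leq_mul2l le1 orbT.
exists D; split=> // [|n x]; last by have [_ _ ->] := DP n.
have p2 := poly_bounded_mul (poly_bounded_const 2)
             (poly_bounded_exp_log (b := 2) isT depthD).
apply: poly_bounded_le p2; exists 0 => n _.
by have [sD _ _] := DP n; rewrite expnS in sD.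
Qed.

Theorem theorem1p2 (C : forall t : nat, circuit (perm_bit t))
  (C_depth : isO (fun t => circuit_depth (C t)) log2)
  (C_decides : exists T : nat, forall t : nat, T <= t ->
     exists2 alpha : {perm 'I_t}, alpha \in ('Alt_('I_t))%g &
       decides_product ('Alt_('I_t))%g alpha
         (fun x : 'I_t -> {perm 'I_t} => circuit_eval (C t) (pointwise x))) :
  forall A : language, NC1 A <-> Lpoly A.
Proof.
move: C_decides => [T C_dec] A; split; first exact: NC1_sub_Lpoly.
exact: Lpoly_sub_NC1 C_depth C_dec A.
Qed.
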